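(* Let $\alpha_1,\alpha_2,\beta\in\mathbb{R}$ with $\alpha_1\alpha_2<0$, and set $\beta_1=\beta_2=\beta$. Assume $s,b\in\mathbb{R}$ satisfy one of: (1) $s<-\frac{13}{12}$ and $b\in\mathbb{R}$; (2) $-\frac{13}{12}\le s\le -1$ and $b\notin[\frac14-\frac s3,\frac43+\frac{2s}3]$; (3) $-1<s<-\frac34$ and $b\notin[\frac14-\frac s3,1+\frac s3]$. Then there is no constant $C=C(\alpha_1,\alpha_2,\beta,s,b)$ such that \[ \|\partial_x(w_1w_2)\|_{X^{\alpha_1,\beta}_{s,b-1}}\le C\|w_1\|_{X^{\alpha_1,\beta}_{s,b}}\|w_2\|_{X^{\alpha_2,\beta}_{s,b}}\quad\text{for all }w_1,w_2. \]
   Context: For $\alpha\ne0$, $\beta\in\mathbb{R}$ let $\phi^{\alpha,\beta}(\xi)=\alpha\xi^3-\beta\xi$ and $\langle x\rangle=1+|x|$. For $s,b\in\mathbb{R}$ the Fourier restriction space $X^{\alpha,\beta}_{s,b}$ is the completion of the Schwartz space $\mathscr{S}(\mathbb{R}^2)$ under the norm $\|w\|_{X^{\alpha,\beta}_{s,b}}=\|\langle\xi\rangle^s\langle\tau-\phi^{\alpha,\beta}(\xi)\rangle^b\widehat w(\xi,\tau)\|_{L^2(d\xi\,d\tau)}$, where $\widehat w$ is the space-time Fourier transform. *)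

(* Defs.v *)
From HB Require Import structures.
From mathcomp Require Import all_boot all_order all_algebra.
From mathcomp Require Import all_classical all_reals all_analysis.
Set Implicit Arguments. Unset Strict Implicit. Unset Printing Implicit Defensive.
Import Order.TTheory GRing.Theory Num.Theory.
Import numFieldNormedType.Exports.
Local Open Scope classical_set_scope.
Local Open Scope ring_scope.

Section Defs.
Variable R : realType.

(* complex-valued functions of (x,t) in R^2, as (real part, imaginary part) *)
Definition cfun := R -> R -> (R * R)%type.

Definition dx (f : cfun) : cfun := fun x t => derive1 (fun y => f y t) x.
Definition dt (f : cfun) : cfun := fun x t => derive1 (fun y => f x y) t.

Definition dseq (s : seq bool) (f : cfun) : cfun :=
  foldr (fun (c : bool) g => if c then dx g else dt g) f s.

Definition schwartz (f : cfun) : Prop :=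
  forall s : seq bool,
    [/\ continuous (fun p : R * R => dseq s f p.1 p.2),
        (forall x t, derivable (fun y => dseq s f y t) x 1),
        (forall x t, derivable (fun y => dseq s f x y) t 1) &
        (forall m n : nat, exists C : R, forall x t,
            `|x| ^+ m * `|t| ^+ n * `|dseq s f x t| <= C)].

Definition cmul (f g : cfun) : cfun := fun x t =>
  ((f x t).1 * (g x t).1 - (f x t).2 * (g x t).2,
   (f x t).1 * (g x t).2 + (f x t).2 * (g x t).1).

Definition leb2 := ((@lebesgue_measure R) \x (@lebesgue_measure R))%E.

(* space-time Fourier transform  hat w (xi,tau) = \int\int e^{-i(x xi + t tau)} w(x,t) dx dt *)
Definition ft_re (f : cfun) (xi tau : R) : R :=
  Rintegral leb2 setT (fun p : R * R =>
    cos (p.1 * xi + p.2 * tau) * (f p.1 p.2).1 + sin (p.1 * xi + p.2 * tau) * (f p.1 p.2).2).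
Definition ft_im (f : cfun) (xi tau : R) : R :=
  Rintegral leb2 setT (fun p : R * R =>
    cos (p.1 * xi + p.2 * tau) * (f p.1 p.2).2 - sin (p.1 * xi + p.2 * tau) * (f p.1 p.2).1).

Definition jb (x : R) : R := 1 + `|x|.

Definition phi (alpha beta xi : R) : R := alpha * xi ^+ 3 - beta * xi.

Definition Xnorm (alpha beta s b : R) (f : cfun) : \bar R :=
  sqrte (\int[leb2]_(p in setT)
    (((powR (jb p.1) s * powR (jb (p.2 - phi alpha beta p.1)) b) ^+ 2 *
      ((ft_re f p.1 p.2) ^+ 2 + (ft_im f p.1 p.2) ^+ 2))%:E))%E.

End Defs.

(* Main.v *)
Require Import Defs.
From HB Require Import structures.
From mathcomp Require Import all_boot all_order all_algebra.
From mathcomp Require Import all_classical all_reals all_analysis.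
From mathcomp Require Import measurable_realfun ring lra.
Set Implicit Arguments. Unset Strict Implicit. Unset Printing Implicit Defensive.
Import Order.TTheory GRing.Theory Num.Theory.
Import numFieldNormedType.Exports.
Local Open Scope classical_set_scope.
Local Open Scope ring_scope.

(** The estimate is tested on Gaussian wave packets. A packet is concentrated,
    in Fourier space, on a parallelogram of width [d] in [xi] and height [1]
    in [tau], and the product of two packets with the same shape is again such
    a packet, at the sum of the two frequencies. If the modulation
    [tau - phi xi] has size about [<l>] on it, its norm is comparable to
    [<a>^s <l>^b d^(-1/2)]. With frequencies of size [N], the estimate then
    becomes an inequality between powers of [N], which fails as [N] grows:
    - frequencies [N] and [1 - N], both on their curves, with [d = N^-2],
      force [b <= 4/3 + 2s/3];
    - frequencies [N] and [N], both on their curves, with [d = N^-2],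
      force [b <= 1 + s/3];
    - frequencies [N] on its curve and [-2N] chosen so that the output [-N] is
      on the output curve, with [d = N^(-1/2)] along the common tangent of the
      first and the output curves, force [b >= 1/4 - s/3].
    For [s < -13/12] the first and the last bounds are incompatible. *)

(** * The Fourier transform of a one-dimensional Gaussian *)

(** Gaussians make both sides explicit: a product of packets is computed in physical space by adding
    exponents, so no convolution of Fourier supports is estimated. The price is that their
    transforms have full support while the weights vary over it. Peetre's inequality compares a
    weight with its value at the centre, up to a polynomial in the rescaled variables, and part of
    the Gaussian absorbs that polynomial. The widths come from Taylor expansion of the cubic. At
    frequency [N] the slope is of order [N^2], so over a width [N^-2] the curve moves by [O(1)] and
    an unsheared packet follows it. Along the tangent only the curvature, of order [N], remains; it
    costs [N d^2], which allows [d = N^(-1/2)]. The two input norms contribute [d^(-1)] and the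
    output [d^(-1/2)], so a factor [d^(-1/2)] stays on the right, and wider packets give stronger
    conditions. The opposite signs of [alpha1] and [alpha2] rule out resonance: the modulation of
    the packet off its curve is a sum of two terms of the same sign, of size [N^3], in which [beta]
    cancels because both curves have the same linear part. *)

Section ContinuousReal.
Variables (R : realType) (T : topologicalType).
Implicit Types f g : T -> R.

Lemma continuous_mulf f g : continuous f -> continuous g ->
  continuous (fun x => f x * g x).
Proof. by move=> cf cg x; exact: (cvgM (cf x) (cg x)). Qed.

Lemma continuous_addf f g : continuous f -> continuous g ->
  continuous (fun x => f x + g x).
Proof. by move=> cf cg x; exact: (cvgD (cf x) (cg x)). Qed.

Lemma continuous_subf f g : continuous f -> continuous g ->
  continuous (fun x => f x - g x).
Proof. by move=> cf cg x; exact: (cvgB (cf x) (cg x)). Qed.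

Lemma continuous_compf (h : R -> R) f : continuous h -> continuous f ->
  continuous (fun x => h (f x)).
Proof. by move=> ch cf x; exact: (continuous_comp (cf x) (ch (f x))). Qed.

Lemma continuous_constf (a : R) : continuous (fun _ : T => a).
Proof. by move=> x; exact: cvg_cst. Qed.

End ContinuousReal.

Section Gauss1D.
Variable R : realType.
Implicit Types k m p th x y : R.
Local Notation leb := (@lebesgue_measure R).

Definition gauss k m x : R := expR (- (k * (x - m) ^+ 2)).

Lemma gauss_gt0 k m x : 0 < gauss k m x.
Proof. exact: expR_gt0. Qed.

Lemma gauss_normal_fun k m : 0 < k -> gauss k m = normal_fun m (Num.sqrt (2 * k)^-1).
Proof.
move=> k0; apply/funext => x; rewrite /gauss /normal_fun; congr expR.
rewrite sqr_sqrtr ?invr_ge0 ?mulr_ge0 ?ltW// -mulr_natr; field.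
by rewrite gt_eqF.
Qed.

Lemma measurable_gauss k m : measurable_fun setT (gauss k m).
Proof.
apply: measurableT_comp => //=; apply: measurableT_comp => //=.
apply: measurable_funM => //=; apply: measurable_funX => //=.
exact: measurable_funB.
Qed.

Lemma integral_gauss k m : 0 < k ->
  (\int[leb]_x (gauss k m x)%:E = (Num.sqrt (pi / k))%:E)%E.
Proof.
move=> k0; set s := Num.sqrt (2 * k)^-1.
have s0 : s != 0 by rewrite gt_eqF// sqrtr_gt0 invr_gt0 mulr_gt0.
have peak_gt0 := normal_peak_gt0 s0.
have -> : (fun x => (gauss k m x)%:E) =
    (fun x => (normal_peak s)^-1%:E * (normal_pdf m s x)%:E)%E.
  apply/funext => x; rewrite gauss_normal_fun// normal_pdfE// -EFinM mulrA mulVf ?mul1r//.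
  by rewrite gt_eqF.
rewrite integralZl//=; last exact: integrable_normal_pdf.
rewrite integral_normal_pdf mule1 /normal_peak invrK; congr ((Num.sqrt _)%:E).
rewrite sqr_sqrtr ?invr_ge0 ?mulr_ge0 ?ltW// -mulr_natr; field.
by rewrite gt_eqF.
Qed.

Lemma integrable_gauss k m : 0 < k -> leb.-integrable setT (EFin \o gauss k m).
Proof.
move=> k0; apply/integrableP; split.
  by apply/measurable_EFinP; exact: measurable_gauss.
under eq_integral do rewrite /= ger0_norm ?expR_ge0//.
by rewrite integral_gauss// ltry.
Qed.

Lemma jb_ge1 x : 1 <= jb x.
Proof. by rewrite lerDl. Qed.

Lemma jb_gt0 x : 0 < jb x.
Proof. exact: lt_le_trans (jb_ge1 x). Qed.

Lemma powR_jb_le_expR r x : 0 <= r -> powR (jb x) r <= expR (r * `|x|).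
Proof.
move=> r0; rewrite mulrC expRM; apply: ge0_ler_powR => //.
- by rewrite nnegrE ltW// jb_gt0.
- by rewrite nnegrE expR_ge0.
- exact: expR_ge1Dx.
Qed.

(** Since [1 + |x| <= exp |x|], it is enough to complete the square in [r |x| - k x^2]. This bound
    absorbs every polynomial loss below. *)
Lemma powR_jb_gauss r k x : 0 <= r -> 0 < k ->
  powR (jb x) r * expR (- (k * x ^+ 2)) <= expR (r ^+ 2 / (4 * k)).
Proof.
move=> r0 k0; apply: le_trans (_ : expR (r * `|x|) * expR (- (k * x ^+ 2)) <= _).
  by rewrite ler_pM2r ?expR_gt0 ?powR_jb_le_expR.
rewrite -expRD ler_expR -(real_normK (num_real x)) -subr_ge0.
rewrite [X in 0 <= X](_ : _ = k * (`|x| - r / (2 * k)) ^+ 2); last first.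
  by field; rewrite gt_eqF.
by rewrite mulr_ge0 ?sqr_ge0 ?ltW.
Qed.

(** Half of the exponent pays for the linear factor; the other half remains as an integrable
    majorant. *)
Lemma norm_gauss_le k m x : 0 < k ->
  `|x - m| * gauss k m x <= expR (1 / (2 * k)) * gauss (k / 2) m x.
Proof.
move=> k0; rewrite /gauss (_ : expR (- (k * _)) =
  expR (- (k / 2 * (x - m) ^+ 2)) * expR (- (k / 2 * (x - m) ^+ 2))); last first.
  by rewrite -expRD; congr expR; field.
rewrite mulrA ler_pM2r ?expR_gt0//.
have k20 : 0 < k / 2 by rewrite divr_gt0.
have := @powR_jb_gauss 1 (k/2) (x-m) ler01 k20.
rewrite powRr1 ?(ltW (jb_gt0 _))//.
have -> : 1 ^+ 2 / (4 * (k / 2)) = 1 / (2 * k) by field; rewrite gt_eqF.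
by apply: le_trans; rewrite ler_pM2r ?expR_gt0// lerDr.
Qed.

Lemma integrable_dominated_gauss (f : R -> R) C k m : 0 < k ->
  measurable_fun setT f -> (forall x, `|f x| <= C * gauss k m x) ->
  leb.-integrable setT (EFin \o f).
Proof.
move=> k0 mf fC.
apply: (@le_integrable _ _ _ leb setT measurableT _ (fun x => C%:E * (EFin \o gauss k m) x)%E).
- exact/measurable_EFinP.
- move=> x _; rewrite /= lee_fin (le_trans (fC x))//.
  exact: ler_norm.
- apply: integrableZl => //; exact: integrable_gauss.
Qed.


Lemma is_derive_continuous (f g : R -> R) :
  (forall x, is_derive x 1 f (g x)) -> continuous f.
Proof.
by move=> fg x; apply/differentiable_continuous/derivable1_diffP; exact: ex_derive.
Qed.

Lemma integral_derivative_eq0 (F f : R -> R) :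
  (forall x, is_derive x 1 F (f x)) -> continuous f ->
  leb.-integrable setT (EFin \o f) ->
  F n%:R @[n --> \oo] --> (0:R) -> F (- n%:R) @[n --> \oo] --> (0:R) ->
  (\int[leb]_x (f x)%:E = 0)%E.
Proof.
move=> dF cf intf F1 F2.
have cF := is_derive_continuous dF.
(* The successor keeps the interval nondegenerate at [n = 0], as the fundamental theorem of calculus
   requires. *)
pose D n := `[- n.+1%:R : R, n.+1%:R]%classic.
have int_D n : (\int[leb]_x ((f \_ (D n)) x)%:E = (F n.+1%:R - F (- n.+1%:R))%:E)%E.
  have -> : (fun x => ((f \_ (D n)) x)%:E) = ((EFin \o f) \_ (D n)).
    by rewrite restrict_EFin.
  rewrite -integral_mkcond /D (@continuous_FTC2 _ f F)//.
  - by rewrite -subr_gt0 opprK addr_gt0.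
  - exact: continuous_subspaceT.
  - split.
    + by move=> x _; exact: ex_derive.
    + by apply: cvg_at_right_filter; exact: cF.
    + by apply: cvg_at_left_filter; exact: cF.
  - by move=> x _; rewrite derive1E derive_val.
have mf : measurable_fun setT f by exact: continuous_measurable_fun.
have cvgI : (\int[leb]_x ((f \_ (D n)) x)%:E)%E @[n --> \oo] --> (\int[leb]_x (f x)%:E)%E.
  apply: (@dominated_cvg _ _ _ leb setT measurableT (fun n x => ((f \_ (D n)) x)%:E)
    (fun x => (f x)%:E) (fun x => `|f x|%:E)).
  - move=> n; apply/measurable_EFinP.
    have mD : measurable (D n) by exact: measurable_itv.
    exact: (iffLR (measurable_restrictT f mD) (measurable_funTS mf)).
  - move=> x _; apply: cvg_EFin; first exact: nearW.
    apply: cvg_near_cst; near=> n; rewrite /= patchE mem_set//.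
    rewrite /D /= in_itv/= -ler_norml; near: n.
    exists (Num.truncn `|x|) => // n /= xn.
    by rewrite ltW// (lt_le_trans (truncnS_gt _))// ler_nat.
  - by [].
  - exact: integrable_norm.
  - move=> n x _; rewrite patchE lee_fin; case: ifP => //.
    by rewrite normr0.
have cvgI0 : (\int[leb]_x ((f \_ (D n)) x)%:E)%E @[n --> \oo] --> (0%R%:E : \bar R).
  under eq_fun do rewrite int_D.
  apply: cvg_EFin; first exact: nearW.
  rewrite -[0]subr0; apply: cvgB.
  - by have := F1; rewrite -(cvg_shiftS (fun n => F n%:R)).
  - by have := F2; rewrite -(cvg_shiftS (fun n => F (- n%:R))).
exact: (cvg_unique _ cvgI cvgI0).
Unshelve. all: end_near. Qed.

Lemma is_derive_gauss k m x :
  is_derive x 1 (gauss k m) (- (2 * k * (x - m)) * gauss k m x).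
Proof.
pose h y : R := - (k * (y - m) ^+ 2).
have dh : is_derive x 1 h (- (2 * k * (x - m))).
  rewrite /h; apply: is_derive_eq; rewrite /GRing.scale/=; ring.
rewrite mulrC /gauss -[in X in is_derive _ _ X]/(expR \o h).
exact: is_derive1_comp.
Qed.

(** Centring the phase at the mean [m] leaves only [cos th] after integration, by parity. The free
    [th] later carries the dependence on [t] in iterated integrals, and the shift by [pi / 2] that
    exchanges sines and cosines. *)
Let phase p m th x := (x - m) * p + th.

Let is_derive_phase p m th x : is_derive x 1 (phase p m th) p.
Proof. by rewrite /phase; apply: is_derive_eq; rewrite /GRing.scale/=; ring. Qed.

Let is_derive_phase_p p m th x : is_derive p 1 (fun p => phase p m th x) (x - m).
Proof. by rewrite /phase; apply: is_derive_eq; rewrite /GRing.scale/=; ring. Qed.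

Let continuous_phase p m th : continuous (phase p m th).
Proof. by apply: is_derive_continuous => x; exact: is_derive_phase. Qed.

Let measurable_phase p m th : measurable_fun setT (phase p m th).
Proof. exact: continuous_measurable_fun. Qed.

Let mcos p m th : measurable_fun setT (fun x => cos (phase p m th x)).
Proof.
apply: measurableT_comp => //; apply: continuous_measurable_fun.
exact: continuous_cos.
Qed.

Let msin p m th : measurable_fun setT (fun x => sin (phase p m th x)).
Proof.
apply: measurableT_comp => //; apply: continuous_measurable_fun.
exact: continuous_sin.
Qed.

Lemma integrable_cos_gauss k m p th : 0 < k ->
  leb.-integrable setT (EFin \o (fun x => cos (phase p m th x) * gauss k m x)).
Proof.
move=> k0; apply: (@integrable_dominated_gauss _ 1 _ m k0).
  by apply: measurable_funM => //; exact: measurable_gauss.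
move=> x; rewrite mul1r normrM (ger0_norm (ltW (gauss_gt0 _ _ _))) ler_piMl ?cos_max//.
exact/ltW/gauss_gt0.
Qed.

Lemma integrable_sin_gauss k m p th : 0 < k ->
  leb.-integrable setT
    (EFin \o (fun x => (x - m) * sin (phase p m th x) * gauss k m x)).
Proof.
move=> k0; have k20 : 0 < k / 2 by rewrite divr_gt0.
apply: (@integrable_dominated_gauss _ (expR (1 / (2 * k))) _ m k20).
  apply: measurable_funM => //; last exact: measurable_gauss.
  by apply: measurable_funM => //; exact: measurable_funB.
move=> x; rewrite !normrM (ger0_norm (ltW (gauss_gt0 _ _ _))).
apply: le_trans (norm_gauss_le m x k0).
by rewrite ler_pM2r ?gauss_gt0// ler_piMr ?sin_max.
Qed.

Lemma gauss_le_expR k m x : 0 < k -> gauss k m x <= expR (1 / (4 * k)) * expR (- (x - m)).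
Proof.
move=> k0; rewrite /gauss -expRD ler_expR -subr_ge0.
rewrite [X in 0 <= X](_ : _ = k * ((x - m) - 1 / (2 * k)) ^+ 2); last first.
  by field; rewrite gt_eqF.
by rewrite mulr_ge0 ?sqr_ge0 ?ltW.
Qed.


(** The derivative of [sin ((x - m) p + th) exp (- k (x - m)^2)] has integral zero. *)
Lemma integral_parts_gauss k m p th : 0 < k ->
  (\int[leb]_x ((x - m) * sin (phase p m th x) * gauss k m x) =
   p / (2 * k) * \int[leb]_x (cos (phase p m th x) * gauss k m x))%R.
Proof.
move=> k0.
pose F x := sin (phase p m th x) * gauss k m x.
pose f1 x := cos (phase p m th x) * gauss k m x.
pose f2 x := (x - m) * sin (phase p m th x) * gauss k m x.
pose f x := p * f1 x - (2 * k) * f2 x.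
have dF x : is_derive x 1 F (f x).
  have dgs := is_derive_gauss k m x.
  have dsin : is_derive x 1 (sin \o phase p m th) (p * cos (phase p m th x)).
    rewrite mulrC; exact: is_derive1_comp.
  apply: (@is_derive_eq _ _ _ ((sin \o phase p m th) * gauss k m)).
  rewrite /GRing.scale/= /f /f1 /f2; ring.
have cgs : continuous (gauss k m).
  by apply: is_derive_continuous => x; exact: is_derive_gauss.
have cf : continuous f.
  have cc : continuous (fun x => cos (phase p m th x)).
    by move=> x; apply: continuous_comp; [exact: continuous_phase|exact: continuous_cos].
  have cs : continuous (fun x => sin (phase p m th x)).
    by move=> x; apply: continuous_comp; [exact: continuous_phase|exact: continuous_sin].
  apply: continuous_subf; apply: continuous_mulf; try exact: continuous_constf.
    by apply: continuous_mulf; [exact: cc|exact: cgs].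
  apply: continuous_mulf; [|exact: cgs].
  apply: continuous_mulf; [|exact: cs].
  by apply: continuous_subf; [move=> x; exact: cvg_id|exact: continuous_constf].
have i1 := integrable_cos_gauss m p th k0.
have i2 := integrable_sin_gauss m p th k0.
have i1' : leb.-integrable setT (EFin \o (fun x => p * f1 x)).
  exact: (integrableZl measurableT p i1).
have i2' : leb.-integrable setT (EFin \o (fun x => 2 * k * f2 x)).
  exact: (integrableZl measurableT (2 * k) i2).
have intf : leb.-integrable setT (EFin \o f).
  exact: (integrableB measurableT i1' i2').
have F0 u : (`|gauss k m (u n)| @[n --> \oo] --> (0:R)) -> F (u n) @[n --> \oo] --> (0:R).
  move=> gu; apply: norm_cvg0; apply: squeeze_cvgr (cvg_cst 0) gu.
  by apply: nearW => n; rewrite normr_ge0/= normrM ler_piMl// sin_max.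
have gsn m' : `|gauss k m' n%:R| @[n --> \oo] --> (0:R).
  pose C := expR (1 / (4 * k)) * expR m'.
  have C0 : C * expR (- n%:R) @[n --> \oo] --> (0:R).
    by rewrite -[X in _ --> X](mulr0 C); apply: cvgM; [exact: cvg_cst|exact: cvgn_expR].
  apply: squeeze_cvgr (cvg_cst 0) C0; apply: nearW => n.
  rewrite normr_ge0/= ger0_norm ?(ltW (gauss_gt0 _ _ _))//.
  by rewrite (le_trans (gauss_le_expR _ _ k0))// /C -mulrA -!expRD opprB.
have gsNn : `|gauss k m (- n%:R)| @[n --> \oo] --> (0:R).
  have -> : (fun n => `|gauss k m (- n%:R)|) = (fun n => `|gauss k (- m) n%:R|).
    by apply/funext => n; congr (`|expR (- _)|); ring.
  exact: gsn.
have f0 := integral_derivative_eq0 dF cf intf (F0 (fun n => n%:R) (gsn m))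
  (F0 (fun n => - n%:R) gsNn).
have fE : \int[leb]_x f x =
    p * \int[leb]_x f1 x - (2 * k) * \int[leb]_x f2 x.
  by rewrite /f RintegralB// RintegralZl// RintegralZl.
have {}fE : p * \int[leb]_x f1 x = (2 * k) * \int[leb]_x f2 x.
  by apply/eqP; rewrite -subr_eq0 -fE /Rintegral f0.
rewrite -[LHS]/(\int[leb]_x f2 x) -[X in _ * X]/(\int[leb]_x f1 x).
rewrite mulrAC fE; field; by rewrite gt_eqF.
Qed.

Let H k m th p : R := \int[leb]_x (cos (phase p m th x) * gauss k m x).

(** The classical linear differential equation of the Gaussian transform: differentiation under the
    integral brings down [x - m], and integration by parts converts the result back into [H]. *)
Let is_derive_H k m th p : 0 < k -> is_derive p 1 (H k m th) (- (p / (2 * k)) * H k m th p).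
Proof.
move=> k0; have k20 : 0 < k / 2 by rewrite divr_gt0.
pose f q x := cos (phase q m th x) * gauss k m x.
pose G x := expR (1 / (2 * k)) * gauss (k / 2) m x.
have df (q x : R) : is_derive q 1 (f ^~ x : R -> R) (- ((x - m) * sin (phase q m th x) * gauss k m x)).
  have dcos : is_derive q 1 (cos \o (fun q => phase q m th x)) (- sin (phase q m th x) * (x - m)).
    exact: is_derive1_comp.
  have -> : f ^~ x = (fun q => gauss k m x *: (cos \o (fun q => phase q m th x)) q).
    by apply/funext => r; rewrite /f /= /GRing.scale/= mulrC.
  apply: is_derive_eq; rewrite /GRing.scale/=; ring.
have d1f q x : partial1of2 f q x = - ((x - m) * sin (phase q m th x) * gauss k m x).
  by rewrite partial1of2E derive_val.
have Ip : (`]p - 1, p + 1[%classic : set R) p.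
  by rewrite /= in_itv/= ltrBlDr ltrDl ltr01.
have intf q : (`]p - 1, p + 1[%classic : set R) q -> leb.-integrable setT (EFin \o f q).
  by move=> _; exact: integrable_cos_gauss.
have derf q x : (`]p - 1, p + 1[%classic : set R) q -> setT x -> derivable (f ^~ x) q 1.
  by move=> _ _; exact: ex_derive.
have G0 x : 0 <= G x by rewrite mulr_ge0// ?expR_ge0// ltW// gauss_gt0.
have intG : leb.-integrable setT (EFin \o G).
  exact: (integrableZl measurableT _ (integrable_gauss m k20)).
have Gub q x : (`]p - 1, p + 1[%classic : set R) q -> setT x -> `|partial1of2 f q x| <= G x.
  move=> _ _; rewrite d1f normrN !normrM (ger0_norm (ltW (gauss_gt0 _ _ _))).
  rewrite (le_trans _ (norm_gauss_le m x k0))//.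
  by rewrite ler_pM2r ?gauss_gt0// ler_piMr ?sin_max.
have dH := derivable_under_integral measurableT Ip intf derf G0 intG Gub.
have H' := differentiation_under_integral measurableT Ip intf derf G0 intG Gub.
apply: DeriveDef; first exact: dH.
rewrite -derive1E H'; under eq_Rintegral do rewrite d1f -mulN1r.
rewrite RintegralZl//; last exact: integrable_sin_gauss.
by rewrite integral_parts_gauss// mulN1r mulNr.
Qed.

Lemma Rintegral_cos_gauss k m p th : 0 < k ->
  \int[leb]_x (cos ((x - m) * p + th) * gauss k m x) =
  cos th * Num.sqrt (pi / k) * expR (- (p ^+ 2 / (4 * k))).
Proof.
move=> k0; pose h q : R := q ^+ 2 / (4 * k).
have dh (q : R) : is_derive q 1 h (q / (2 * k)).
  have -> : h = fun q => (4 * k)^-1 *: (q ^+ 2) by apply/funext => r; rewrite /h mulrC.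
  apply: is_derive_eq; rewrite /GRing.scale/=; field; by rewrite gt_eqF.
have dE (q : R) : is_derive q 1 (expR \o h) (expR (h q) * (q / (2 * k))) by exact: is_derive1_comp.
(* [expR \o h] is the integrating factor of the equation, so this product equals its value at
   [p = 0], where the integral is the plain Gaussian one. *)
have dK (q : R) : is_derive q 1 (H k m th * (expR \o h)) 0.
  have := is_derive_H m th q k0 => ?.
  apply: is_derive_eq; rewrite /GRing.scale/=; ring.
have := is_derive_0_is_cst p 0 dK.
have h0 : h 0 = 0 by rewrite /h expr0n/= mul0r.
rewrite !fctE /= h0 expR0 mulr1 => HpE.
rewrite -[LHS]/(H k m th p) expRN -[LHS](mulfK (lt0r_neq0 (expR_gt0 (h p)))) HpE.
rewrite /H /phase /h; congr (_ / _).
under eq_Rintegral do rewrite mulr0 add0r.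
by rewrite RintegralZl// ?integrable_gauss// /Rintegral integral_gauss.
Qed.

Lemma Rintegral_sin_gauss k m p th : 0 < k ->
  \int[leb]_x ((x - m) * sin ((x - m) * p + th) * gauss k m x) =
  p / (2 * k) * (cos th * Num.sqrt (pi / k) * expR (- (p ^+ 2 / (4 * k)))).
Proof. by move=> k0; rewrite integral_parts_gauss// Rintegral_cos_gauss. Qed.

End Gauss1D.

(** * Wave packets and their Fourier transforms *)

Section Packet.
Variable R : realType.
Local Notation leb := (@lebesgue_measure R).
Local Notation leb2 := (@leb2 R).

Lemma is_derive_pair (f g : R -> R) (x a b : R) :
  is_derive x 1 f a -> is_derive x 1 g b ->
  is_derive x 1 (fun y => (f y, g y)) (a, b).
Proof.
move=> df dg.
have Hf : h^-1 *: (f (h *: 1 + x) - f x) @[h --> 0^'] --> a.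
  by have := @ex_derive _ _ _ _ _ _ _ df; rewrite -(@derive_val _ _ _ _ _ _ _ df).
have Hg : h^-1 *: (g (h *: 1 + x) - g x) @[h --> 0^'] --> b.
  by have := @ex_derive _ _ _ _ _ _ _ dg; rewrite -(@derive_val _ _ _ _ _ _ _ dg).
have H : h^-1 *: ((f (h *: 1 + x), g (h *: 1 + x)) - (f x, g x)) @[h --> 0^'] --> (a, b).
  exact: (cvg_pair Hf Hg).
apply: DeriveDef; first by apply/cvg_ex; exists (a, b).
exact/cvg_lim.
Qed.

Lemma Rintegral_iterated (F : R * R -> R) (h : R -> R) :
  leb2.-integrable setT (EFin \o F) ->
  (forall t, leb.-integrable setT (EFin \o (fun x => F (x, t)))) ->
  (forall t, Rintegral leb setT (fun x => F (x, t)) = h t) ->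
  Rintegral leb2 setT F = Rintegral leb setT h.
Proof.
move=> iF sF Fh; rewrite /Rintegral -(integral21_prod_meas1 iF); congr fine.
apply: eq_integral => t _; rewrite /fubini_G -Fh /Rintegral fineK//.
by apply: integrable_fin_num => //; exact: sF.
Qed.

Section Gauss2.
Variables (c k1 k2 : R).
Hypotheses (k10 : 0 < k1) (k20 : 0 < k2).

Definition gauss2 (c k1 k2 : R) (z : R * R) : R := gauss k1 (- (c * z.2)) z.1 * gauss k2 0 z.2.

Lemma measurable_gauss2 : measurable_fun setT (gauss2 c k1 k2).
Proof.
apply: measurable_funM.
  apply: measurableT_comp => //=; apply: measurableT_comp => //=.
  apply: measurable_funM => //=; apply: measurable_funX => //=.
  apply: measurable_funB; first exact: measurable_fst.
  apply: measurableT_comp => //=; apply: measurable_funM => //=.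
apply: measurableT_comp => //; exact: measurable_gauss.
Qed.

Lemma integrable_gauss2 : leb2.-integrable setT (EFin \o gauss2 c k1 k2).
Proof.
apply/integrable21ltyP.
  by apply/measurable_EFinP; exact: measurable_gauss2.
have -> : (fun t => \int[leb]_x `|(EFin \o gauss2 c k1 k2) (x, t)|)%E =
    (fun t => (Num.sqrt (pi / k1))%:E * (EFin \o gauss k2 0) t)%E.
  apply/funext => t.
  under eq_integral => x _.
    rewrite /gauss2/= ger0_norm; last by rewrite mulr_ge0// ltW ?gauss_gt0.
    rewrite mulrC EFinM.
    over.
  rewrite integralZl//=; last exact: integrable_gauss.
  by rewrite integral_gauss// muleC.
rewrite integralZl//=; last exact: integrable_gauss.
by rewrite integral_gauss// -EFinM ltry.
Qed.

Lemma integrable_dominated_gauss2 (F : R * R -> R) C :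
  measurable_fun setT F -> (forall z, `|F z| <= C * gauss2 c k1 k2 z) ->
  leb2.-integrable setT (EFin \o F).
Proof.
move=> mF FC.
apply: (@le_integrable _ _ _ leb2 setT measurableT _ (fun x => C%:E * (EFin \o gauss2 c k1 k2) x)%E).
- exact/measurable_EFinP.
- by move=> x _; rewrite /= lee_fin (le_trans (FC x))// ler_norm.
- by apply: integrableZl => //; exact: integrable_gauss2.
Qed.

End Gauss2.

(** One formula for four transforms: [v = 0] gives the packet and [v] equal to [2 k1] up to sign its
    [x]-derivative, while [th = 0] or [pi / 2] selects the real or imaginary part. For fixed [t] the
    Gaussian in [x] is centred at [- c t], and rewriting the phase around that centre leaves the
    frequency [q - c p] for the integral in [t]: the shear passes to the Fourier side. *)
Lemma Rintegral_wave (c k1 k2 u v p q th : R) : 0 < k1 -> 0 < k2 ->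
  Rintegral leb2 setT (fun z : R * R =>
    (u * cos (z.1 * p + z.2 * q + th) +
     v * (z.1 + c * z.2) * sin (z.1 * p + z.2 * q + th)) * gauss2 c k1 k2 z) =
  (u + v * (p / (2 * k1))) * cos th *
  (Num.sqrt (pi / k1) * expR (- (p ^+ 2 / (4 * k1)))) *
  (Num.sqrt (pi / k2) * expR (- ((q - c * p) ^+ 2 / (4 * k2)))).
Proof.
move=> k10 k20.
pose S1 := Num.sqrt (pi / k1) * expR (- (p ^+ 2 / (4 * k1))).
pose U := u + v * (p / (2 * k1)).
rewrite (@Rintegral_iterated _ (fun t => U * S1 * (cos ((t - 0) * (q - c * p) + th) * gauss k2 0 t))).
- rewrite RintegralZl//; last exact: integrable_cos_gauss.
  by rewrite Rintegral_cos_gauss// /U /S1; ring.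
(* The majorant has [k1 / 2] because half of the Gaussian in [x + c t] absorbs the linear factor. *)
- have k10' : 0 < k1 / 2 by rewrite divr_gt0.
  apply: (@integrable_dominated_gauss2 c _ _ k10' k20 _ (`|u| + `|v| * expR (1 / (2 * k1)))).
    apply: measurable_funM; last exact: measurable_gauss2.
    have mX : measurable_fun setT (fun z : R * R => z.1 * p + z.2 * q + th).
      apply: measurable_funD => //; apply: measurable_funD; exact: measurable_funM.
    apply: measurable_funD; apply: measurable_funM => //.
    + by apply: measurableT_comp => //; apply: continuous_measurable_fun; exact: continuous_cos.
    + apply: measurable_funM => //; apply: measurable_funD; first exact: measurable_fst.
      exact: measurable_funM.
    + by apply: measurableT_comp => //; apply: continuous_measurable_fun; exact: continuous_sin.
  move=> z; rewrite normrM /gauss2 normrM.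
  rewrite (ger0_norm (ltW (gauss_gt0 _ _ _))) (ger0_norm (ltW (gauss_gt0 _ _ _))).
  rewrite !mulrA ler_pM2r ?gauss_gt0//.
  apply: le_trans (_ : (`|u| + `|v| * `|z.1 + c * z.2|) * gauss k1 (- (c * z.2)) z.1 <= _).
    rewrite ler_pM2r ?gauss_gt0// (le_trans (ler_normD _ _))// !normrM.
    by rewrite lerD// ler_piMr ?cos_max ?sin_max ?mulr_ge0.
  rewrite !(mulrDl `|u|) lerD//.
    rewrite ler_wpM2l// /gauss ler_expR lerN2 ler_wpM2r ?sqr_ge0//.
    by rewrite ler_pdivrMr// ler_pMr// ler1n.
  rewrite -!mulrA ler_wpM2l//.
  by have := norm_gauss_le (- (c * z.2)) z.1 k10; rewrite opprK.
- move=> t /=.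
  have i1 := integrable_cos_gauss (- (c * t)) p (t * (q - c * p) + th) k10.
  have i2 := integrable_sin_gauss (- (c * t)) p (t * (q - c * p) + th) k10.
  have := integrableD measurableT
    (integrableZl measurableT (u * gauss k2 0 t) i1) (integrableZl measurableT (v * gauss k2 0 t) i2).
  apply: eq_integrable => // x _ /=; rewrite -!EFinM -EFinD; congr EFin.
  rewrite /gauss2 /= opprK (_ : _ + (_ + th) = x * p + t * q + th); ring.
- move=> t /=.
  have i1 := integrable_cos_gauss (- (c * t)) p (t * (q - c * p) + th) k10.
  have i2 := integrable_sin_gauss (- (c * t)) p (t * (q - c * p) + th) k10.
  have j1 := integrableZl measurableT (u * gauss k2 0 t) i1.
  have j2 := integrableZl measurableT (v * gauss k2 0 t) i2.
  have := RintegralD measurableT j1 j2.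
  rewrite !RintegralZl// Rintegral_cos_gauss// Rintegral_sin_gauss// subr0.
  have <- : U * S1 * (cos (t * (q - c * p) + th) * gauss k2 0 t) =
     u * gauss k2 0 t * (cos (t * (q - c * p) + th) * Num.sqrt (pi / k1) * expR (- (p ^+ 2 / (4 * k1)))) +
     v * gauss k2 0 t * (p / (2 * k1) * (cos (t * (q - c * p) + th) * Num.sqrt (pi / k1) * expR (- (p ^+ 2 / (4 * k1))))).
    by rewrite /U /S1; ring.
  move=> <-; apply: eq_Rintegral => x _ /=.
  rewrite /gauss2 /= opprK (_ : _ + (_ + th) = x * p + t * q + th); ring.
Qed.

(** [exp (i (a x + w t) - k1 (x + c t)^2 - k2 t^2)]; in Fourier space [c] is the slope
    of the parallelogram, centred at [(a, w)], on which the packet concentrates. *)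
Definition packet (a w c k1 k2 : R) : cfun R := fun x t =>
  (cos (a * x + w * t) * gauss2 c k1 k2 (x, t), sin (a * x + w * t) * gauss2 c k1 k2 (x, t)).

Lemma cmul_packet a1 a2 w1 w2 c k1 k2 :
  cmul (packet a1 w1 c k1 k2) (packet a2 w2 c k1 k2) = packet (a1 + a2) (w1 + w2) c (2 * k1) (2 * k2).
Proof.
apply/funext => x; apply/funext => t; rewrite /cmul /packet /=.
have -> : (a1 + a2) * x + (w1 + w2) * t = (a1 * x + w1 * t) + (a2 * x + w2 * t) by ring.
have -> : gauss2 c (2 * k1) (2 * k2) (x, t) = gauss2 c k1 k2 (x, t) * gauss2 c k1 k2 (x, t).
  by rewrite /gauss2 /gauss /= -!expRD; congr expR; ring.
by rewrite (cosD (a1 * x + w1 * t)) (sinD (a1 * x + w1 * t)); congr pair; ring.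
Qed.

(** The arguments are the coordinates [p = xi - a] and [r = tau - w - c (xi - a)] adapted to the
    parallelogram of the packet. *)
Definition packet_hat (k1 k2 p r : R) : R :=
  (Num.sqrt (pi / k1) * expR (- (p ^+ 2 / (4 * k1)))) *
  (Num.sqrt (pi / k2) * expR (- (r ^+ 2 / (4 * k2)))).

Lemma ft_re_packet a w c k1 k2 xi tau : 0 < k1 -> 0 < k2 ->
  ft_re (packet a w c k1 k2) xi tau = packet_hat k1 k2 (xi - a) (tau - w - c * (xi - a)).
Proof.
move=> k10 k20.
have := Rintegral_wave c 1 0 (xi - a) (tau - w) 0 k10 k20.
rewrite cos0 mul0r addr0 !mul1r -/(packet_hat _ _ _ _) => <-.
apply: eq_Rintegral => z _ /=; rewrite addr0 !mul0r addr0 mul1r.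
have -> : z.1 * (xi - a) + z.2 * (tau - w) = (z.1 * xi + z.2 * tau) - (a * z.1 + w * z.2) by ring.
by rewrite cosB -surjective_pairing; ring.
Qed.

Lemma ft_im_packet a w c k1 k2 xi tau : 0 < k1 -> 0 < k2 ->
  ft_im (packet a w c k1 k2) xi tau = 0.
Proof.
move=> k10 k20.
have := Rintegral_wave c 1 0 (xi - a) (tau - w) (pi / 2) k10 k20.
rewrite cos_pihalf mulr0 !mul0r => <-.
apply: eq_Rintegral => z _ /=; rewrite !mul0r addr0 mul1r cosDpihalf.
have -> : z.1 * (xi - a) + z.2 * (tau - w) = (z.1 * xi + z.2 * tau) - (a * z.1 + w * z.2) by ring.
by rewrite sinB -surjective_pairing; ring.
Qed.

Lemma dx_packet a w c k1 k2 x t :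
  dx (packet a w c k1 k2) x t =
  ((- a * sin (a * x + w * t) - 2 * k1 * (x + c * t) * cos (a * x + w * t)) * gauss2 c k1 k2 (x, t),
   (a * cos (a * x + w * t) - 2 * k1 * (x + c * t) * sin (a * x + w * t)) * gauss2 c k1 k2 (x, t)).
Proof.
pose th y : R := a * y + w * t.
have dth : is_derive x 1 th a.
  by rewrite /th; apply: is_derive_eq; rewrite /GRing.scale/=; ring.
have dg := is_derive_gauss k1 (- (c * t)) x.
have dc : is_derive x 1 (cos \o th) (- sin (th x) * a) by exact: is_derive1_comp.
have ds : is_derive x 1 (sin \o th) (cos (th x) * a) by exact: is_derive1_comp.
rewrite /dx derive1E.
have -> : (fun y => packet a w c k1 k2 y t) =
   (fun y => ((gauss k2 0 t *: ((cos \o th) * gauss k1 (- (c * t)))) y,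
              (gauss k2 0 t *: ((sin \o th) * gauss k1 (- (c * t)))) y)).
  by apply/funext => y; rewrite /packet /gauss2 /= !fctE /= /th; congr pair; rewrite /GRing.scale/=; ring.
apply: derive_val; apply: is_derive_pair; apply: is_derive_eq;
  rewrite /GRing.scale/= /gauss2 /th /=; ring.
Qed.

Lemma ft_re_dx_packet a w c k1 k2 xi tau : 0 < k1 -> 0 < k2 ->
  ft_re (dx (packet a w c k1 k2)) xi tau = 0.
Proof.
move=> k10 k20.
have := Rintegral_wave c (- a) (- (2 * k1)) (xi - a) (tau - w) (pi / 2) k10 k20.
rewrite cos_pihalf mulr0 !mul0r => <-.
apply: eq_Rintegral => z _; rewrite dx_packet cosDpihalf sinDpihalf /=.
have -> : z.1 * (xi - a) + z.2 * (tau - w) = (z.1 * xi + z.2 * tau) - (a * z.1 + w * z.2) by ring.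
by rewrite sinB cosB -surjective_pairing; ring.
Qed.

Lemma ft_im_dx_packet a w c k1 k2 xi tau : 0 < k1 -> 0 < k2 ->
  ft_im (dx (packet a w c k1 k2)) xi tau = xi * packet_hat k1 k2 (xi - a) (tau - w - c * (xi - a)).
Proof.
move=> k10 k20.
have := Rintegral_wave c a (2 * k1) (xi - a) (tau - w) 0 k10 k20.
(* The carrier contributes [a] and the derivative of the envelope contributes [xi - a]; together
   they form the multiplier [xi]. *)
have -> : a + 2 * k1 * ((xi - a) / (2 * k1)) = xi by field; rewrite gt_eqF.
rewrite cos0 mulr1 -mulrA -/(packet_hat _ _ _ _) => <-.
apply: eq_Rintegral => z _; rewrite dx_packet addr0 /=.
have -> : z.1 * (xi - a) + z.2 * (tau - w) = (z.1 * xi + z.2 * tau) - (a * z.1 + w * z.2) by ring.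
by rewrite sinB cosB -surjective_pairing; ring.
Qed.

End Packet.

(** * Packets are Schwartz functions *)

Section Schwartz.
Variable R : realType.

Section Wave.
Variables (a w c k1 k2 : R).
Hypotheses (k10 : 0 < k1) (k20 : 0 < k2).

(** Real and imaginary parts of polynomials times a packet: unlike packets, they are
    stable under both partial derivatives. *)
Inductive wave : (R -> R -> R) -> Prop :=
| wave_cos : wave (fun x t => cos (a * x + w * t) * gauss2 c k1 k2 (x, t))
| wave_sin : wave (fun x t => sin (a * x + w * t) * gauss2 c k1 k2 (x, t))
| wave_add f g : wave f -> wave g -> wave (fun x t => f x t + g x t)
| wave_scale r f : wave f -> wave (fun x t => r * f x t)
| wave_mulx f : wave f -> wave (fun x t => x * f x t)
| wave_mult f : wave f -> wave (fun x t => t * f x t).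

Lemma is_derive_gauss2x (x t : R) : is_derive x 1 (fun y => gauss2 c k1 k2 (y, t))
  (- (2 * k1 * (x + c * t)) * gauss2 c k1 k2 (x, t)).
Proof.
have dg := is_derive_gauss k1 (- (c * t)) x.
have -> : (fun y => gauss2 c k1 k2 (y, t)) = gauss k2 0 t *: gauss k1 (- (c * t)).
  by apply/funext => y; rewrite /gauss2 /= !fctE /GRing.scale /= mulrC.
by apply: is_derive_eq; rewrite /GRing.scale/= /gauss2 /=; ring.
Qed.

Lemma is_derive_gauss2t (x t : R) : is_derive t 1 (fun y => gauss2 c k1 k2 (x, y))
  ((- (2 * k1 * c * (x + c * t)) - 2 * k2 * t) * gauss2 c k1 k2 (x, t)).
Proof.
pose h y : R := - (k1 * (x + c * y) ^+ 2) - k2 * y ^+ 2.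
have dh : is_derive t 1 h (- (2 * k1 * c * (x + c * t)) - 2 * k2 * t).
  by rewrite /h; apply: is_derive_eq; rewrite /GRing.scale/=; ring.
have E y : gauss2 c k1 k2 (x, y) = expR (h y).
  by rewrite /gauss2 /gauss /= -expRD; congr expR; rewrite /h; ring.
rewrite E mulrC (_ : (fun y => _) = expR \o h); last by apply/funext => y; rewrite /= E.
exact: is_derive1_comp.
Qed.

Lemma wave_linear (p q r : R) f : wave f ->
  wave (fun x t => (p * x + q * t + r) * f x t).
Proof.
move=> wf.
have -> : (fun x t => (p * x + q * t + r) * f x t) =
  (fun x t => p * (x * f x t) + q * (t * f x t) + r * f x t).
  by apply/funext => x; apply/funext => t; ring.
by do 2 ?apply: wave_add; apply: wave_scale => //; constructor.
Qed.

Lemma is_derive_wave_x f : wave f ->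
  exists2 g, wave g & forall x t : R, is_derive x 1 (f ^~ t) (g x t).
Proof.
have dth (x t : R) : is_derive x 1 (fun x : R => a * x + w * t) a.
  by apply: is_derive_eq; rewrite /GRing.scale/=; ring.
elim=> {f} [||f g wf [f' wf' df] wg [g' wg' dg]|r f wf [f' wf' df]
  |f wf [f' wf' df]|f wf [f' wf' df]].
- pose f x t := cos (a * x + w * t) * gauss2 c k1 k2 (x, t).
  pose g x t := sin (a * x + w * t) * gauss2 c k1 k2 (x, t).
  exists (fun x t => (- a) * g x t + (- (2 * k1) * x + - (2 * k1 * c) * t + 0) * f x t).
    apply: wave_add; [apply: wave_scale; exact: wave_sin|].
    by apply: wave_linear; exact: wave_cos.
  move=> x t; have dG := is_derive_gauss2x x t.
  have dc : is_derive x 1 (cos \o (fun x : R => a * x + w * t)) (- sin (a * x + w * t) * a).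
    exact: is_derive1_comp.
  rewrite (_ : (fun x => _) = (cos \o (fun x : R => a * x + w * t)) * (fun x => gauss2 c k1 k2 (x, t)))//.
  by apply: is_derive_eq; rewrite /GRing.scale /= /f /g; ring.
- pose f x t := cos (a * x + w * t) * gauss2 c k1 k2 (x, t).
  pose g x t := sin (a * x + w * t) * gauss2 c k1 k2 (x, t).
  exists (fun x t => a * f x t + (- (2 * k1) * x + - (2 * k1 * c) * t + 0) * g x t).
    apply: wave_add; [apply: wave_scale; exact: wave_cos|].
    by apply: wave_linear; exact: wave_sin.
  move=> x t; have dG := is_derive_gauss2x x t.
  have dc : is_derive x 1 (sin \o (fun x : R => a * x + w * t)) (cos (a * x + w * t) * a).
    exact: is_derive1_comp.
  rewrite (_ : (fun x => _) = (sin \o (fun x : R => a * x + w * t)) * (fun x => gauss2 c k1 k2 (x, t)))//.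
  by apply: is_derive_eq; rewrite /GRing.scale /= /f /g; ring.
- exists (fun x t => f' x t + g' x t); first exact: wave_add.
  move=> x t; have := df x t; have := dg x t => ? ?.
  exact: (is_deriveD (f := f ^~ t) (g := g ^~ t)).
- exists (fun x t => r * f' x t); first exact: wave_scale.
  move=> x t; have := df x t => ?; exact: (is_deriveZ (f := f ^~ t)).
- exists (fun x t => f x t + x * f' x t).
    by apply: wave_add => //; exact: wave_mulx.
  move=> x t; have := df x t => ?.
  rewrite (_ : (fun x => _) = id * (f ^~ t))//.
  by apply: is_derive_eq; rewrite /GRing.scale/=; ring.
- exists (fun x t => t * f' x t); first exact: wave_mult.
  move=> x t; have := df x t => ?; exact: (is_deriveZ (f := f ^~ t)).
Qed.

Lemma is_derive_wave_t f : wave f ->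
  exists2 g, wave g & forall x t : R, is_derive t 1 (f x) (g x t).
Proof.
have dth (x t : R) : is_derive t 1 (fun t : R => a * x + w * t) w.
  by apply: is_derive_eq; rewrite /GRing.scale/=; ring.
elim=> {f} [||f g wf [f' wf' df] wg [g' wg' dg]|r f wf [f' wf' df]
  |f wf [f' wf' df]|f wf [f' wf' df]].
- pose f x t := cos (a * x + w * t) * gauss2 c k1 k2 (x, t).
  pose g x t := sin (a * x + w * t) * gauss2 c k1 k2 (x, t).
  exists (fun x t => (- w) * g x t +
      (- (2 * k1 * c) * x + (- (2 * k1 * c * c) - 2 * k2) * t + 0) * f x t).
    apply: wave_add; [apply: wave_scale; exact: wave_sin|].
    by apply: wave_linear; exact: wave_cos.
  move=> x t; have dG := is_derive_gauss2t x t.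
  have dc : is_derive t 1 (cos \o (fun t : R => a * x + w * t)) (- sin (a * x + w * t) * w).
    exact: is_derive1_comp.
  rewrite (_ : (fun t => _) = (cos \o (fun t : R => a * x + w * t)) * (fun t => gauss2 c k1 k2 (x, t)))//.
  by apply: is_derive_eq; rewrite /GRing.scale /= /f /g; ring.
- pose f x t := cos (a * x + w * t) * gauss2 c k1 k2 (x, t).
  pose g x t := sin (a * x + w * t) * gauss2 c k1 k2 (x, t).
  exists (fun x t => w * f x t +
      (- (2 * k1 * c) * x + (- (2 * k1 * c * c) - 2 * k2) * t + 0) * g x t).
    apply: wave_add; [apply: wave_scale; exact: wave_cos|].
    by apply: wave_linear; exact: wave_sin.
  move=> x t; have dG := is_derive_gauss2t x t.
  have dc : is_derive t 1 (sin \o (fun t : R => a * x + w * t)) (cos (a * x + w * t) * w).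
    exact: is_derive1_comp.
  rewrite (_ : (fun t => _) = (sin \o (fun t : R => a * x + w * t)) * (fun t => gauss2 c k1 k2 (x, t)))//.
  by apply: is_derive_eq; rewrite /GRing.scale /= /f /g; ring.
- exists (fun x t => f' x t + g' x t); first exact: wave_add.
  move=> x t; have := df x t; have := dg x t => ? ?.
  exact: (is_deriveD (f := f x) (g := g x)).
- exists (fun x t => r * f' x t); first exact: wave_scale.
  move=> x t; have := df x t => ?; exact: (is_deriveZ (f := f x)).
- exists (fun x t => x * f' x t); first exact: wave_mulx.
  move=> x t; have := df x t => ?; exact: (is_deriveZ (f := f x)).
- exists (fun x t => f x t + t * f' x t).
    by apply: wave_add => //; exact: wave_mult.
  move=> x t; have := df x t => ?.
  rewrite (_ : (fun t => _) = id * (f x))//.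
  by apply: is_derive_eq; rewrite /GRing.scale/=; ring.
Qed.

Let cfst : continuous (fun p : R * R => p.1).
Proof. by move=> p; exact: cvg_fst. Qed.

Let csnd : continuous (fun p : R * R => p.2).
Proof. by move=> p; exact: cvg_snd. Qed.

Lemma continuous_wave f : wave f -> continuous (fun p : R * R => f p.1 p.2).
Proof.
have cth : continuous (fun p : R * R => a * p.1 + w * p.2).
  by apply: continuous_addf; apply: continuous_mulf => //; exact: continuous_constf.
have cgs k m : continuous (gauss k m : R -> R).
  by apply: is_derive_continuous => x; exact: is_derive_gauss.
have cG : continuous (fun p : R * R => gauss2 c k1 k2 (p.1, p.2)).
  apply: continuous_mulf; last by apply: continuous_compf => //; exact: cgs.
  have -> : (fun p : R * R => gauss k1 (- (c * (p.1, p.2).2)) (p.1, p.2).1) =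
      (fun p => gauss k1 0 (p.1 + c * p.2)).
    by apply/funext => p; rewrite /gauss/= opprK subr0.
  apply: continuous_compf; first exact: cgs.
  by apply: continuous_addf => //; apply: continuous_mulf => //; exact: continuous_constf.
elim=> {f} [||f g wf cf wg cg|r f wf cf|f wf cf|f wf cf].
- by apply: continuous_mulf => //; apply: continuous_compf => //; exact: continuous_cos.
- by apply: continuous_mulf => //; apply: continuous_compf => //; exact: continuous_sin.
- exact: continuous_addf.
- by apply: continuous_mulf => //; exact: continuous_constf.
- exact: continuous_mulf.
- exact: continuous_mulf.
Qed.

(** The Gaussian decays in [x + c t] and in [t]. Writing [x] as [(x + c t) - c t] bounds [|x|] by a
    multiple of the product of the two brackets, so [t] has to pay for [m + n] powers. *)
Lemma gauss2_decay (m n : nat) : exists C : R, forall x t,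
  `|x| ^+ m * `|t| ^+ n * gauss2 c k1 k2 (x, t) <= C.
Proof.
pose C1 := expR (m%:R ^+ 2 / (4 * k1)).
pose C2 := expR ((m + n)%:R ^+ 2 / (4 * k2)).
exists ((1 + `|c|) ^+ m * (C1 * C2)) => x t.
have H1 : jb (x + c * t) ^+ m * gauss k1 (- (c * t)) x <= C1.
  have := powR_jb_gauss (x + c * t) (ler0n R m) k10.
  by rewrite powR_mulrn ?(ltW (jb_gt0 _))// /gauss opprK.
have H2 : jb t ^+ (m + n) * gauss k2 0 t <= C2.
  have := powR_jb_gauss t (ler0n R (m + n)) k20.
  by rewrite powR_mulrn ?(ltW (jb_gt0 _))// /gauss subr0.
have Hx : `|x| <= (1 + `|c|) * (jb (x + c * t) * jb t).
  have -> : `|x| = `|(x + c * t) - c * t| by congr (`|_|); ring.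
  rewrite (le_trans (ler_normB _ _))// normrM /jb.
  have := normr_ge0 (x + c * t); have := normr_ge0 c; have := normr_ge0 t.
  move: (`|x + c * t|) (`|c|) (`|t|) => A B D D0 B0 A0.
  rewrite -subr_ge0.
  have -> : (1 + B) * ((1 + A) * (1 + D)) - (A + B * D) =
     1 + D + A * D + B + B * A + B * (A * D) by ring.
  by rewrite !addr_ge0// !mulr_ge0.
have Ht : `|t| <= jb t by rewrite lerDr.
rewrite /gauss2 /=.
apply: le_trans (_ : ((1 + `|c|) * (jb (x + c * t) * jb t)) ^+ m * jb t ^+ n *
  (gauss k1 (- (c * t)) x * gauss k2 0 t) <= _).
  rewrite ler_wpM2r ?mulr_ge0 ?(ltW (gauss_gt0 _ _ _))//.
  by apply: ler_pM; rewrite ?exprn_ge0// lerXn2r// nnegrE ?mulr_ge0 ?addr_ge0 ?(ltW (jb_gt0 _)).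
have -> : ((1 + `|c|) * (jb (x + c * t) * jb t)) ^+ m * jb t ^+ n *
  (gauss k1 (- (c * t)) x * gauss k2 0 t) = (1 + `|c|) ^+ m *
   ((jb (x + c * t) ^+ m * gauss k1 (- (c * t)) x) * (jb t ^+ (m + n) * gauss k2 0 t)).
  by rewrite !exprMn exprD; ring.
rewrite ler_wpM2l ?exprn_ge0 ?addr_ge0//.
by apply: ler_pM => //; rewrite mulr_ge0 ?exprn_ge0 ?(ltW (gauss_gt0 _ _ _)) ?(ltW (jb_gt0 _)).
Qed.

Lemma wave_decay f : wave f -> forall m n : nat, exists C : R, forall x t,
  `|x| ^+ m * `|t| ^+ n * `|f x t| <= C.
Proof.
elim=> {f} [||f g wf cf wg cg|r f wf cf|f wf cf|f wf cf] m n.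
- have [C HC] := gauss2_decay m n; exists C => x t; apply: le_trans (HC x t).
  rewrite normrM (ger0_norm (_ : 0 <= gauss2 _ _ _ _)) ?mulr_ge0 ?(ltW (gauss_gt0 _ _ _))//.
  by rewrite ler_wpM2l ?mulr_ge0 ?exprn_ge0// ler_piMl ?cos_max// mulr_ge0 ?(ltW (gauss_gt0 _ _ _)).
- have [C HC] := gauss2_decay m n; exists C => x t; apply: le_trans (HC x t).
  rewrite normrM (ger0_norm (_ : 0 <= gauss2 _ _ _ _)) ?mulr_ge0 ?(ltW (gauss_gt0 _ _ _))//.
  by rewrite ler_wpM2l ?mulr_ge0 ?exprn_ge0// ler_piMl ?sin_max// mulr_ge0 ?(ltW (gauss_gt0 _ _ _)).
- have [C1 H1] := cf m n; have [C2 H2] := cg m n; exists (C1 + C2) => x t.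
  rewrite (le_trans _ (lerD (H1 x t) (H2 x t)))// -mulrDr.
  by rewrite ler_wpM2l ?mulr_ge0 ?exprn_ge0// ler_normD.
- have [C HC] := cf m n; exists (`|r| * C) => x t.
  by rewrite normrM mulrCA ler_wpM2l.
- have [C HC] := cf m.+1 n; exists C => x t; apply: le_trans (HC x t).
  by rewrite normrM mulrCA !mulrA -exprS.
- have [C HC] := cf m n.+1; exists C => x t; apply: le_trans (HC x t).
  by rewrite normrM mulrA -(mulrA (_ ^+ _)) -exprSr.
Qed.

Lemma dseq_packet s : exists u v, [/\ wave u, wave v &
  dseq s (packet a w c k1 k2) = fun x t => (u x t, v x t)].
Proof.
elim: s => [|b s [u [v [wu wv E]]]].
  exists (fun x t => cos (a * x + w * t) * gauss2 c k1 k2 (x, t)).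
  exists (fun x t => sin (a * x + w * t) * gauss2 c k1 k2 (x, t)).
  by split; [exact: wave_cos|exact: wave_sin|].
rewrite /= -/(dseq s _) E; case: b.
- have [u' wu' du] := is_derive_wave_x wu; have [v' wv' dv] := is_derive_wave_x wv.
  exists u', v'; split => //; apply/funext => x; apply/funext => t.
  by rewrite /dx derive1E; apply: derive_val; exact: is_derive_pair.
- have [u' wu' du] := is_derive_wave_t wu; have [v' wv' dv] := is_derive_wave_t wv.
  exists u', v'; split => //; apply/funext => x; apply/funext => t.
  by rewrite /dt derive1E; apply: derive_val; exact: is_derive_pair.
Qed.

Lemma schwartz_packet : schwartz (packet a w c k1 k2).
Proof.
move=> s; have [u [v [wu wv ->]]] := dseq_packet s; split.
- move=> p.
  have cu : (u q.1 q.2) @[q --> p] --> u p.1 p.2 by exact: (continuous_wave wu).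
  have cv : (v q.1 q.2) @[q --> p] --> v p.1 p.2 by exact: (continuous_wave wv).
  exact: (cvg_pair cu cv).
- move=> x t; have [u' _ du] := is_derive_wave_x wu; have [v' _ dv] := is_derive_wave_x wv.
  exact: (@ex_derive _ _ _ _ _ _ _ (is_derive_pair (du x t) (dv x t))).
- move=> x t; have [u' _ du] := is_derive_wave_t wu; have [v' _ dv] := is_derive_wave_t wv.
  exact: (@ex_derive _ _ _ _ _ _ _ (is_derive_pair (du x t) (dv x t))).
- move=> m n; have [C1 H1] := wave_decay wu m n; have [C2 H2] := wave_decay wv m n.
  exists (C1 + C2) => x t; rewrite (le_trans _ (lerD (H1 x t) (H2 x t)))// -mulrDr.
  rewrite ler_wpM2l ?mulr_ge0 ?exprn_ge0// prod_normE /= ge_max.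
  by rewrite lerDl normr_ge0 lerDr normr_ge0.
Qed.

End Wave.
End Schwartz.

(** * Norms of packets *)

Ltac nonneg := repeat first
  [ done | exact: expR_ge0 | exact: sqr_ge0 | exact: sqrtr_ge0 | exact: powR_ge0
  | exact: pi_ge0 | exact: normr_ge0 | exact/ltW/jb_gt0 | exact: ltW
  | apply: mulr_ge0 | apply: addr_ge0 | apply: exprn_ge0 | rewrite invr_ge0 ].

Section NormBounds.
Variable R : realType.
Local Notation leb := (@lebesgue_measure R).
Local Notation leb2 := (@leb2 R).

(** Integrating in the second variable first, the shear is a mere translation. Asking for the
    integral of every translate of [g] replaces a two-dimensional change of variables. *)
Lemma integral_sheared (f g : R -> R) (A B a w c : R) :
  measurable_fun setT f -> measurable_fun setT g ->
  (forall x, 0 <= f x) -> (forall x, 0 <= g x) ->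
  (\int[leb]_x (f x)%:E = A%:E)%E ->
  (forall m, \int[leb]_x (g (x - m))%:E = B%:E)%E ->
  (\int[leb2]_z (f z.1 * g (z.2 - w - c * (z.1 - a)))%:E = (A * B)%:E)%E.
Proof.
move=> mf mg f0 g0 fA gB.
rewrite fubini_tonelli1; last 2 first.
- apply/measurable_EFinP; apply: measurable_funM.
    exact: (measurableT_comp mf measurable_fst).
  apply: (measurableT_comp mg); apply: measurable_funB.
    by apply: measurable_funB => //; exact: measurable_snd.
  by apply: measurable_funM => //; apply: measurable_funB => //; exact: measurable_fst.
- by move=> z; rewrite lee_fin mulr_ge0.
rewrite /fubini_F /=.
under eq_integral => x _.
  under eq_integral => y _ do rewrite -addrA -opprD EFinM.
  rewrite ge0_integralZl//=; first last.
  - by rewrite lee_fin.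
  - by move=> y _; rewrite lee_fin.
  - apply/measurable_EFinP; apply: (measurableT_comp mg).
    exact: measurable_funB.
  rewrite gB muleC.
  over.
rewrite ge0_integralZl ?fA//=; first by rewrite -EFinM mulrC.
- exact/measurable_EFinP.
- by move=> x _; rewrite lee_fin.
- by rewrite -(gB 0); apply: integral_ge0 => x _; rewrite lee_fin.
Qed.

Lemma integral_indic_itv (m r : R) : 0 < r ->
  (\int[leb]_x (\1_(`[(m - r)%R, (m + r)%R]%classic) x)%:E = (2 * r)%:E)%E.
Proof.
move=> r0.
have mI : measurable (`[m - r, m + r]%classic : set R) by exact: measurable_itv.
rewrite (@integral_indic _ _ R leb setT measurableT _ mI).
rewrite setIT; have := @lebesgue_measure_itv R `[m - r, m + r] => H; apply: etrans H _.
rewrite /= lte_fin ifT; last by rewrite ltrD2l; lra.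
by rewrite -EFinD; congr (_%:E); ring.
Qed.

Lemma packet_hat_sqr k1 k2 p r : 0 < k1 -> 0 < k2 ->
  packet_hat k1 k2 p r ^+ 2 =
  (pi / k1) * (pi / k2) * (expR (- (p ^+ 2 / (2 * k1))) * expR (- (r ^+ 2 / (2 * k2)))) :> R.
Proof.
move=> k10 k20; rewrite /packet_hat !exprMn !sqr_sqrtr ?divr_ge0 ?pi_ge0 ?ltW//.
have E k (x : R) : 0 < k -> expR (- (x ^+ 2 / (4 * k))) ^+ 2 = expR (- (x ^+ 2 / (2 * k))).
  by move=> k0; rewrite expr2 -expRD; congr expR; field; rewrite gt_eqF.
by rewrite !E//; ring.
Qed.

Section Weights.
Variables alpha beta s b : R.

Definition weight (z : R * R) : R :=
  powR (jb z.1) s * powR (jb (z.2 - phi alpha beta z.1)) b.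

Lemma weight_ge0 z : 0 <= weight z.
Proof. by rewrite mulr_ge0// powR_ge0. Qed.

Lemma measurable_weight : measurable_fun setT weight.
Proof.
have mjb (f : R * R -> R) : measurable_fun setT f -> measurable_fun setT (fun z => jb (f z)).
  by move=> mf; apply: measurable_funD => //; exact: measurableT_comp.
apply: measurable_funM; apply: (measurableT_comp (measurable_powR _)); apply: mjb => //.
apply: measurable_funB => //; apply: measurable_funB; apply: measurable_funM => //.
by apply: measurable_funX.
Qed.

Lemma Xnorm_packetE a w c k1 k2 : 0 < k1 -> 0 < k2 ->
  Xnorm alpha beta s b (packet a w c k1 k2) =
  sqrte (\int[leb2]_z ((weight z * packet_hat k1 k2 (z.1 - a) (z.2 - w - c * (z.1 - a))) ^+ 2)%:E)%E.
Proof.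
move=> k10 k20; rewrite /Xnorm; congr sqrte; apply: eq_integral => z _.
by rewrite ft_re_packet// ft_im_packet// expr0n/= addr0 -exprMn.
Qed.

Lemma Xnorm_dx_packetE a w c k1 k2 : 0 < k1 -> 0 < k2 ->
  Xnorm alpha beta s b (dx (packet a w c k1 k2)) =
  sqrte (\int[leb2]_z
    ((weight z * (z.1 * packet_hat k1 k2 (z.1 - a) (z.2 - w - c * (z.1 - a)))) ^+ 2)%:E)%E.
Proof.
move=> k10 k20; rewrite /Xnorm; congr sqrte; apply: eq_integral => z _.
by rewrite ft_re_dx_packet// ft_im_dx_packet// expr0n/= add0r -exprMn.
Qed.

Lemma measurable_packet_hat a w c k1 k2 :
  measurable_fun setT (fun z : R * R => packet_hat k1 k2 (z.1 - a) (z.2 - w - c * (z.1 - a))).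
Proof.
have mg (k : R) (f : R * R -> R) : measurable_fun setT f ->
    measurable_fun setT (fun z => Num.sqrt (pi / k) * expR (- (f z ^+ 2 / (4 * k)))).
  move=> mf; apply: measurable_funM => //; apply: measurableT_comp => //.
  by apply: measurableT_comp => //; apply: measurable_funM => //; exact: measurable_funX.
have m1 : measurable_fun setT (fun z : R * R => z.1 - a) by apply: measurable_funB.
apply: measurable_funM; apply: mg => //; apply: measurable_funB.
  by apply: measurable_funB => //; exact: measurable_snd.
exact: measurable_funM.
Qed.

(** The parameters are halved so that the product of two such packets has parameters [d^2] and [1].
    The squared transform is then [exp (- u^2 - v^2)] up to a constant, in the rescaled variables:
    half of each square absorbs the weight, and the other half is integrated. *)
Lemma Xnorm_packet_le_of_weight (r M a w c d : R) : 0 <= r -> 0 <= M -> 0 < d ->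
  (forall z, weight z <=
    M * powR (jb ((z.1 - a) / d) * jb (z.2 - w - c * (z.1 - a))) r) ->
  (Xnorm alpha beta s b (packet a w c (d ^+ 2 / 2) (1 / 2)) <=
   (M * expR (2 * r ^+ 2) * Num.sqrt (8 * pi ^+ 3) * Num.sqrt d^-1)%:E)%E.
Proof.
move=> r0 M0 d0 HW.
have k10 : 0 < d ^+ 2 / 2 by rewrite divr_gt0// exprn_gt0.
have k20 : 0 < 1 / 2 :> R by rewrite divr_gt0.
have pi0 := pi_ge0 R.
rewrite Xnorm_packetE//.
(* Each of the two directions costs [expR (2 * r ^+ 2)] for the squared weight; the last factor is
   the squared amplitude of the transform. *)
pose K := (M * expR (2 * r ^+ 2)) ^+ 2 * (4 * pi ^+ 2 / d ^+ 2).
pose f := gauss (1 / (2 * d ^+ 2)) a.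
pose g : R -> R := gauss (1 / 2) 0.
have kf : 0 < 1 / (2 * d ^+ 2) by rewrite divr_gt0// mulr_gt0// exprn_gt0.
have K0 : 0 <= K by rewrite /K; nonneg.

have HK z : (weight z * packet_hat (d ^+ 2 / 2) (1 / 2) (z.1 - a) (z.2 - w - c * (z.1 - a))) ^+ 2
    <= K * (f z.1 * g (z.2 - w - c * (z.1 - a))).
  set p := z.1 - a; set v := z.2 - w - c * p; set u := p / d.
  rewrite exprMn packet_hat_sqr//.
  have W2 : weight z ^+ 2 <= (M * powR (jb u * jb v) r) ^+ 2.
    by rewrite lerXn2r ?nnegrE ?mulr_ge0 ?powR_ge0 ?weight_ge0.
  apply: le_trans (ler_wpM2r _ W2) _.
    by nonneg.
  have jE x : powR (jb x) r ^+ 2 * expR (- (1 / 2 * x ^+ 2)) <= expR (2 * r ^+ 2) :> R.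
    have := @powR_jb_gauss R (r * 2) (1 / 2) x (mulr_ge0 r0 (ler0n _ _)) k20.
    rewrite powRrM powR_mulrn ?powR_ge0// => /le_trans; apply.
    by rewrite (_ : (r * 2) ^+ 2 / (4 * (1 / 2)) = 2 * r ^+ 2)//; field.
  have -> : expR (- (p ^+ 2 / (2 * (d ^+ 2 / 2)))) =
      expR (- (1 / 2 * u ^+ 2)) * expR (- (1 / (2 * d ^+ 2) * p ^+ 2)) .
    rewrite -expRD; congr expR; rewrite /u; field; by rewrite gt_eqF.
  have -> : expR (- (v ^+ 2 / (2 * (1 / 2)))) =
      expR (- (1 / 2 * v ^+ 2)) * expR (- (1 / 2 * v ^+ 2)).
    by rewrite -expRD; congr expR; field.
  have -> : K * (f z.1 * g v) = M ^+ 2 * (pi / (d ^+ 2 / 2) * (pi / (1 / 2))) *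
     (expR (- (1 / (2 * d ^+ 2) * p ^+ 2)) * expR (- (1 / 2 * v ^+ 2))) *
     (expR (2 * r ^+ 2) * expR (2 * r ^+ 2)).
    rewrite /K /f /g /gauss subr0; field; by rewrite gt_eqF.
  rewrite powRM ?(ltW (jb_gt0 _))//.
  rewrite [X in X <= _](_ : _ = M ^+ 2 * (pi / (d ^+ 2 / 2) * (pi / (1 / 2))) *
     (expR (- (1 / (2 * d ^+ 2) * p ^+ 2)) * expR (- (1 / 2 * v ^+ 2))) *
     ((powR (jb u) r ^+ 2 * expR (- (1 / 2 * u ^+ 2))) *
      (powR (jb v) r ^+ 2 * expR (- (1 / 2 * v ^+ 2))))); last by ring.
  apply: ler_wpM2l.
    by nonneg.
  by apply: ler_pM => //; nonneg.
have If : (\int[leb]_x (f x)%:E = (Num.sqrt (2 * pi) * d)%:E)%E.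
  rewrite integral_gauss//; congr (_%:E).
  rewrite (_ : pi / _ = 2 * pi * d ^+ 2); last by field; rewrite gt_eqF.
  by rewrite sqrtrM ?mulr_ge0// sqrtr_sqr gtr0_norm.
have Ig m : (\int[leb]_x (g (x - m))%:E = (Num.sqrt (2 * pi))%:E)%E.
  rewrite (_ : 2 * pi = pi / (1 / 2)); last by field.
  rewrite -(integral_gauss m)//; apply: eq_integral => x _.
  by rewrite /g /gauss subr0.
have mf : measurable_fun setT f by exact: measurable_gauss.
have mg : measurable_fun setT g by exact: measurable_gauss.
have f0 x : 0 <= f x by exact/ltW/gauss_gt0.
have g0 x : 0 <= g x by exact/ltW/gauss_gt0.
have I2 := integral_sheared a w c mf mg f0 g0 If Ig.
have mfg : measurable_fun setT (fun z : R * R => f z.1 * g (z.2 - w - c * (z.1 - a))).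
  apply: measurable_funM; first exact: (measurableT_comp mf measurable_fst).
  apply: (measurableT_comp mg); apply: measurable_funB.
    by apply: measurable_funB => //; exact: measurable_snd.
  by apply: measurable_funM => //; apply: measurable_funB => //; exact: measurable_fst.
have -> : ((M * expR (2 * r ^+ 2) * Num.sqrt (8 * pi ^+ 3) * Num.sqrt d^-1)%:E =
    sqrte (K * (Num.sqrt (2 * pi) * d * Num.sqrt (2 * pi)))%:E)%E.
  rewrite /= (_ : K * _ = (M * expR (2 * r ^+ 2)) ^+ 2 * (8 * pi ^+ 3 * d^-1)).
    rewrite (sqrtrM _ (sqr_ge0 _)) sqrtr_sqr ger0_norm; last by nonneg.
    by rewrite (@sqrtrM _ (8 * pi ^+ 3)) ?mulrA//; nonneg.
  rewrite (_ : Num.sqrt (2 * pi) * d * _ = Num.sqrt (2 * pi) ^+ 2 * d); last by ring.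
  rewrite sqr_sqrtr ?mulr_ge0// /K; field; by rewrite gt_eqF.
rewrite lee_sqrt; last by rewrite lee_fin; nonneg.
rewrite EFinM -I2 -ge0_integralZl//=; first last.
- by move=> z _; rewrite lee_fin mulr_ge0.
- exact/measurable_EFinP.
apply: ge0_le_integral => //=.
- by move=> z _; rewrite lee_fin sqr_ge0.
- apply/measurable_EFinP; apply: measurable_funX; apply: measurable_funM.
    exact: measurable_weight.
  exact: measurable_packet_hat.
- by apply/measurable_EFinP; apply: measurable_funM.
- by move=> z _; rewrite -EFinM lee_fin.
Qed.

(** Only the parallelogram [|u| <= 1], [|v| <= 1] in rescaled variables is kept. It has area [4 d],
    and there the squared transform is at least [pi^2 / d^2 * exp (-1)]. *)
Lemma Xnorm_dx_packet_ge_of_weight (M a w c d : R) : 0 <= M -> 0 < d ->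
  (forall z, `|z.1 - a| <= d -> `|z.2 - w - c * (z.1 - a)| <= 1 ->
    M <= weight z * `|z.1|) ->
  ((M * (2 * pi * expR (- 2^-1)) * Num.sqrt d^-1)%:E <=
    Xnorm alpha beta s b (dx (packet a w c (d ^+ 2) 1)))%E.
Proof.
move=> M0 d0 HW.
have k10 : 0 < d ^+ 2 by rewrite exprn_gt0.
have pi0 := pi_ge0 R.
rewrite Xnorm_dx_packetE//.
pose K := M ^+ 2 * (pi ^+ 2 / d ^+ 2 * expR (-1)).
pose f : R -> R := \1_(`[a - d, a + d]%classic).
pose g : R -> R := \1_(`[-1, 1]%classic).
have K0 : 0 <= K by rewrite /K; nonneg.
have HK z : K * (f z.1 * g (z.2 - w - c * (z.1 - a))) <=
   (weight z * (z.1 * packet_hat (d ^+ 2) 1 (z.1 - a) (z.2 - w - c * (z.1 - a)))) ^+ 2.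
  have [|] := boolP (z.1 \in `[a - d, a + d]); last first.
    by move=> h; rewrite /f indicE memNset ?mul0r ?mulr0 ?sqr_ge0//=; apply/negP.
  move=> zf; have [|] := boolP (z.2 - w - c * (z.1 - a) \in `[-1, 1]); last first.
    by move=> h; rewrite /g indicE memNset ?mulr0 ?sqr_ge0//=; apply/negP.
  move=> zg; rewrite /f /g !indicE !mem_set// !mulr1.
  have zf' : `|z.1 - a| <= d by move: zf; rewrite in_itv/= ler_distl.
  have zg' : `|z.2 - w - c * (z.1 - a)| <= 1 by move: zg; rewrite in_itv/= -ler_norml.
  rewrite mulrA exprMn /K packet_hat_sqr//; apply: ler_pM.
  - exact: sqr_ge0.
  - by nonneg.
  - rewrite -[X in _ <= X]real_normK ?num_real// normrM (ger0_norm (weight_ge0 _)).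
    have wz0 := weight_ge0 z; rewrite lerXn2r ?HW ?nnegrE//; nonneg.
  - rewrite (_ : pi / d ^+ 2 * (pi / 1) = pi ^+ 2 / d ^+ 2); last by field; rewrite gt_eqF.
    rewrite ler_wpM2l//; first by nonneg.
    rewrite -expRD ler_expR.
    have H1 : (z.1 - a) ^+ 2 / (2 * d ^+ 2) <= 1 / 2.
      rewrite ler_pdivrMr ?mulr_gt0// mulrA divfK// mul1r.
      by rewrite -(real_normK (num_real (z.1 - a))) lerXn2r ?nnegrE ?(ltW d0).
    have H2 : (z.2 - w - c * (z.1 - a)) ^+ 2 / (2 * 1) <= 1 / 2.
      set v := z.2 - w - _ in zg' *.
      by rewrite mulr1 ler_wpM2r ?invr_ge0// -(real_normK (num_real v)) expr_le1.
    lra.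
have If := integral_indic_itv a d0.
have Ig m : (\int[leb]_x (g (x - m))%:E = (2 * 1)%:E)%E.
  have -> : (fun x => (g (x - m))%:E) = (fun x => (\1_(`[m - 1, m + 1]%classic) x)%:E).
    apply/funext => x; rewrite /g !indicE; congr (_%:R%:E); congr nat_of_bool.
    apply/idP/idP => /set_mem h; apply/mem_set; move: h; rewrite /= !in_itv/=;
      by move=> /andP[h1 h2]; apply/andP; split; lra.
  exact: integral_indic_itv.
have mf : measurable_fun setT f by apply: measurable_indic; exact: measurable_itv.
have mg : measurable_fun setT g by apply: measurable_indic; exact: measurable_itv.
have f0 x : 0 <= f x by rewrite /f indicE.
have g0 x : 0 <= g x by rewrite /g indicE.
have I2 := integral_sheared a w c mf mg f0 g0 If Ig.
have mfg : measurable_fun setT (fun z : R * R => f z.1 * g (z.2 - w - c * (z.1 - a))).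
  apply: measurable_funM; first exact: (measurableT_comp mf measurable_fst).
  apply: (measurableT_comp mg); apply: measurable_funB.
    by apply: measurable_funB => //; exact: measurable_snd.
  by apply: measurable_funM => //; apply: measurable_funB => //; exact: measurable_fst.
have -> : ((M * (2 * pi * expR (- 2^-1)) * Num.sqrt d^-1)%:E = sqrte (K * (2 * d * (2 * 1)))%:E)%E.
  rewrite /= (_ : K * _ = (M * (2 * pi * expR (- 2^-1))) ^+ 2 * d^-1).
    by rewrite (sqrtrM _ (sqr_ge0 _)) sqrtr_sqr ger0_norm//; nonneg.
  rewrite /K (_ : expR (-1) = expR (- 2^-1) ^+ 2); last first.
    by rewrite expr2 -expRD; congr expR; field.
  field; by rewrite gt_eqF.
rewrite lee_sqrt; last by apply: integral_ge0 => z _; rewrite lee_fin sqr_ge0.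
rewrite EFinM -I2 -ge0_integralZl//=; first last.
- by move=> z _; rewrite lee_fin mulr_ge0.
- exact/measurable_EFinP.
apply: ge0_le_integral => //=.
- by move=> z _; rewrite -EFinM lee_fin; apply: mulr_ge0 => //; exact: mulr_ge0.
- by apply/measurable_EFinP; apply: measurable_funM.
- apply/measurable_EFinP; apply: measurable_funX; apply: measurable_funM.
    exact: measurable_weight.
  by apply: measurable_funM; [exact: measurable_fst|exact: measurable_packet_hat].
- by move=> z _; rewrite -EFinM lee_fin.
Qed.

End Weights.
End NormBounds.

(** * Weights over a packet: Peetre's inequality and uniform norm bounds *)

Section Peetre.
Variable R : realType.
Implicit Types x y s b : R.

Lemma le_of_eq x y : x = y -> x <= y.
Proof. by move=> ->. Qed.

Lemma jb_sub_le x y : jb x <= jb y * jb (x - y).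
Proof.
have := ler_normD y (x - y); rewrite addrC subrK /jb => xy.
have := normr_ge0 y; have := normr_ge0 (x - y).
move: (`|x|) (`|y|) (`|x - y|) xy => A B D; nra.
Qed.

(** For negative [s] the triangle inequality is used with [x] and [y] exchanged, whence the exponent
    [|s|] of the loss. *)
Lemma peetre x y s : powR (jb x) s <= powR (jb y) s * powR (jb (x - y)) `|s|.
Proof.
have jx := jb_gt0 x; have jy := jb_gt0 y; have jd := jb_gt0 (x - y).
have [s0|s0] := leP 0 s.
  rewrite ger0_norm// -powRM ?(ltW jx) ?(ltW jy) ?(ltW jd)// ge0_ler_powR ?nnegrE ?mulr_ge0 ?(ltW jx) ?(ltW jy) ?(ltW jd)//.
  exact: jb_sub_le.
have s0' : 0 <= - s by rewrite oppr_ge0 ltW.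
rewrite -(opprK s) normrN; move: (- s) s0' => q q0.
rewrite ger0_norm// !powRN -ler_pdivrMl; last by rewrite invr_gt0 powR_gt0.
rewrite invrK ler_pdivrMr; last by rewrite powR_gt0.
rewrite mulrC -powRM ?(ltW jx) ?(ltW jy) ?(ltW jd)// ge0_ler_powR ?nnegrE ?mulr_ge0 ?(ltW jx) ?(ltW jy) ?(ltW jd)//.
by rewrite /jb distrC; exact: jb_sub_le.
Qed.

Section Weight.
Variables (alpha beta s b a w c d l0 K : R).
(** The total polynomial loss: [|s|] from the frequency weight and [3 |b|] from the modulation
    weight, whose deviation is at most cubic in [U]. *)
Let r := `|s| + 3 * `|b|.
Let U (z : R * R) := (z.1 - a) / d.
Let V (z : R * R) := z.2 - w - c * (z.1 - a).
Hypotheses (d0 : 0 < d) (d1 : d <= 1) (K1 : 1 <= K).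
Hypothesis modulation : forall z : R * R,
  `|z.2 - phi alpha beta z.1 - l0| <= K * (jb (U z) ^+ 3 * jb (V z)).

Lemma powR_jb_freq z : powR (jb (z.1 - a)) `|s| <= powR (jb (U z) * jb (V z)) `|s|.
Proof.
apply: ge0_ler_powR; rewrite ?nnegrE ?mulr_ge0 ?(ltW (jb_gt0 _))//.
apply: le_trans (_ : jb (U z) <= _); last by rewrite ler_peMr ?jb_ge1 ?(ltW (jb_gt0 _)).
rewrite lerD2l /U normrM ler_peMr// normfV gtr0_norm// invf_ge1//.
Qed.

Lemma powR_jb_modulation z : powR (jb (z.2 - phi alpha beta z.1 - l0)) `|b| <=
  powR (2 * K) `|b| * powR (jb (U z) * jb (V z)) (3 * `|b|).
Proof.
have jU := jb_ge1 (U z); have jV := jb_ge1 (V z).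
have jUV0 : 0 <= jb (U z) * jb (V z) by rewrite mulr_ge0 ?(ltW (jb_gt0 _)).
have K0 : 0 <= K by rewrite (le_trans _ K1).
rewrite powRrM (powR_mulrn 3)// -powRM; [|by nonneg|by nonneg].
apply: ge0_ler_powR; rewrite ?nnegrE; [by []|by nonneg|by nonneg|].
have J : jb (U z) ^+ 3 * jb (V z) <= (jb (U z) * jb (V z)) ^+ 3.
  by rewrite exprMn ler_wpM2l ?exprn_ge0 ?(ltW (jb_gt0 _))// ler_eXnr.
have J1 : 1 <= (jb (U z) * jb (V z)) ^+ 3 by rewrite exprn_ege1// mulr_ege1.
have := modulation z; rewrite [jb (_ - l0)]/jb.
move: J J1.
move: `|z.2 - phi alpha beta z.1 - l0| (jb (U z) ^+ 3 * jb (V z)) ((jb (U z) * jb (V z)) ^+ 3).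
move=> A B C BC C1 AB; rewrite -mulrA.
have KB := ler_wpM2l K0 BC; have KC := mulr_ege1 K1 C1; lra.
Qed.

Lemma weight_le z : weight alpha beta s b z <=
  powR (jb a) s * powR (jb l0) b * powR (2 * K) `|b| * powR (jb (U z) * jb (V z)) r.
Proof.
have j0 : jb (U z) * jb (V z) != 0 by rewrite mulf_neq0// gt_eqF// jb_gt0.
rewrite /r powRD ?j0 ?implybT//.
have P1 := peetre z.1 a s; have P2 := peetre (z.2 - phi alpha beta z.1) l0 b.
have Q1 := powR_jb_freq z; have Q2 := powR_jb_modulation z.
apply: le_trans (ler_pM (powR_ge0 _ _) (powR_ge0 _ _) P1 P2) _.
apply: le_trans (ler_pM _ _ (ler_wpM2l (powR_ge0 (jb a) s) Q1)
  (ler_wpM2l (powR_ge0 (jb l0) b) Q2)) _; rewrite ?mulr_ge0 ?powR_ge0//.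
by apply: le_of_eq; ring.
Qed.

(** Peetre's inequality with the centre and the current point exchanged; the same losses now sit on
    the other side. *)
Lemma weight_ge z : powR (jb a) s * powR (jb l0) b <=
  weight alpha beta s b z * (powR (2 * K) `|b| * powR (jb (U z) * jb (V z)) r).
Proof.
have j0 : jb (U z) * jb (V z) != 0 by rewrite mulf_neq0// gt_eqF// jb_gt0.
rewrite /r powRD ?j0 ?implybT//.
have jbN (x y : R) : jb (x - y) = jb (y - x) by rewrite /jb distrC.
have P1 := peetre a z.1 s; have P2 := peetre l0 (z.2 - phi alpha beta z.1) b.
rewrite (jbN a) in P1; rewrite (jbN l0) in P2.
have Q1 := powR_jb_freq z; have Q2 := powR_jb_modulation z.
apply: le_trans (ler_pM (powR_ge0 _ _) (powR_ge0 _ _) P1 P2) _.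
apply: le_trans (ler_pM _ _ (ler_wpM2l (powR_ge0 (jb z.1) s) Q1)
  (ler_wpM2l (powR_ge0 _ b) Q2)) _; rewrite ?mulr_ge0 ?powR_ge0//.
by apply: le_of_eq; rewrite /weight; ring.
Qed.

End Weight.

(** The constant is chosen before the curve and the packet and depends on [s] and [b] only, so the
    frequency may tend to infinity. The factor in [K] is kept explicit because [K] itself may grow
    with the frequency. *)
Lemma Xnorm_packet_le s b : exists2 C : R, 0 < C &
  forall alpha beta a w c d l0 K : R, 0 < d -> d <= 1 -> 1 <= K ->
  (forall z : R * R, `|z.2 - phi alpha beta z.1 - l0| <=
     K * (jb ((z.1 - a) / d) ^+ 3 * jb (z.2 - w - c * (z.1 - a)))) ->
  (Xnorm alpha beta s b (packet a w c (d ^+ 2 / 2) (1 / 2)) <=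
   (C * (powR (jb a) s * powR (jb l0) b * powR K `|b|) * Num.sqrt d^-1)%:E)%E.
Proof.
pose r := `|s| + 3 * `|b|.
exists (powR 2 `|b| * expR (2 * r ^+ 2) * Num.sqrt (8 * pi ^+ 3)).
  by rewrite !mulr_gt0 ?powR_gt0 ?expR_gt0 ?sqrtr_gt0 ?mulr_gt0 ?exprn_gt0 ?pi_gt0.
move=> alpha beta a w c d l0 K d0 d1 K1 HL.
have r0 : 0 <= r by rewrite addr_ge0 ?mulr_ge0.
have M0 : 0 <= powR (jb a) s * powR (jb l0) b * powR (2 * K) `|b|.
  by rewrite !mulr_ge0 ?powR_ge0.
have := Xnorm_packet_le_of_weight r0 M0 d0 (weight_le s b d0 d1 K1 HL).
move=> /le_trans; apply; rewrite lee_fin powRM ?(le_trans _ K1)//.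
by apply: le_of_eq; ring.
Qed.

Lemma Xnorm_dx_packet_ge s b : exists2 C : R, 0 < C &
  forall alpha beta a w c d l0 K : R, 0 < d -> d <= 1 -> 2 * d <= `|a| -> 1 <= K ->
  (forall z : R * R, `|z.2 - phi alpha beta z.1 - l0| <=
     K * (jb ((z.1 - a) / d) ^+ 3 * jb (z.2 - w - c * (z.1 - a)))) ->
  ((C * (`|a| * powR (jb a) s * powR (jb l0) b / powR K `|b|) * Num.sqrt d^-1)%:E <=
   Xnorm alpha beta s b (dx (packet a w c (d ^+ 2) 1)))%E.
Proof.
pose r := `|s| + 3 * `|b|.
(* On the parallelogram both brackets are at most [2], which gives [powR 4 r]. The leading [2] comes
   from [|z.1| >= |a| / 2], ensured by [2 * d <= |a|], and [powR 2 |b|] from the factor [2 * K] of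
   the modulation bound. *)
exists (1 / (2 * powR 2 `|b| * powR 4 r) * (2 * pi * expR (- 2^-1))).
  by rewrite !mulr_gt0 ?invr_gt0 ?mulr_gt0 ?powR_gt0 ?expR_gt0 ?pi_gt0.
move=> alpha beta a w c d l0 K d0 d1 da K1 HL.
have r0 : 0 <= r by rewrite addr_ge0 ?mulr_ge0.
have K0 : 0 < K by rewrite (lt_le_trans _ K1).
have pK : powR K `|b| != 0 by rewrite gt_eqF// powR_gt0.
have p2 : powR 2 `|b| != 0 :> R by rewrite gt_eqF// powR_gt0.
have p4 : powR 4 r != 0 :> R by rewrite gt_eqF// powR_gt0.
pose M := `|a| * powR (jb a) s * powR (jb l0) b / (2 * powR 2 `|b| * powR 4 r * powR K `|b|).
have M0 : 0 <= M by rewrite /M; nonneg.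
have HM z : `|z.1 - a| <= d -> `|z.2 - w - c * (z.1 - a)| <= 1 ->
    M <= weight alpha beta s b z * `|z.1|.
  move=> hz1 hz2.
  have Wge := weight_ge s b d0 d1 K1 HL z.
  have W0 := weight_ge0 alpha beta s b z.
  have hp : powR (jb ((z.1 - a) / d) * jb (z.2 - w - c * (z.1 - a))) r <= powR 4 r.
    apply: ge0_ler_powR; rewrite ?nnegrE ?mulr_ge0 ?(ltW (jb_gt0 _))//.
    rewrite (_ : 4 = 2 * 2); last by ring.
    apply: ler_pM; rewrite ?(ltW (jb_gt0 _))// /jb (_ : 2 = 1 + 1)// lerD2l//.
    by rewrite normrM normfV (gtr0_norm d0) ler_pdivrMr// mul1r.
  have hz : `|a| / 2 <= `|z.1|.
    have : `|a| <= `|z.1| + `|z.1 - a|.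
      by rewrite -{1}(subKr z.1 a) (le_trans (ler_normB _ _)).
    by lra.
  have {}Wge : powR (jb a) s * powR (jb l0) b <=
      weight alpha beta s b z * (powR 2 `|b| * powR K `|b| * powR 4 r).
    apply: le_trans Wge _; rewrite ler_wpM2l// powRM ?(ltW K0)//.
    by rewrite ler_wpM2l// mulr_ge0 ?powR_ge0.
  have -> : M = (powR (jb a) s * powR (jb l0) b) / (powR 2 `|b| * powR K `|b| * powR 4 r) *
      (`|a| / 2).
    by rewrite /M; field; rewrite p2 p4 pK.
  apply: ler_pM => //; try by nonneg.
  by rewrite ler_pdivrMr// !mulr_gt0 ?powR_gt0.
have := Xnorm_dx_packet_ge_of_weight M0 d0 HM.
apply: le_trans; rewrite lee_fin.
apply: le_of_eq; rewrite /M; field; by rewrite p2 p4 pK.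
Qed.

End Peetre.

(** * Testing the estimate *)

Section Counterexamples.
Variable R : realType.
Implicit Types alpha beta s b a w c d l K N : R.

Definition bilinear_estimate alpha1 alpha2 beta s b C :=
  forall w1 w2 : cfun R, schwartz w1 -> schwartz w2 ->
    (Xnorm alpha1 beta s (b - 1) (dx (cmul w1 w2))
     <= C%:E * Xnorm alpha1 beta s b w1 * Xnorm alpha2 beta s b w2)%E.

(** The bound [K (1+|u|)^3 (1+|v|)], in the rescaled frequency variables [u], [v]
    of a packet, is harmless for norms: it only costs a factor [K^|b|] there. *)
Definition modulated alpha beta a w c d l K :=
  forall z : R * R, `|z.2 - phi alpha beta z.1 - l| <=
     K * (jb ((z.1 - a) / d) ^+ 3 * jb (z.2 - w - c * (z.1 - a))).

Lemma packet_test s b : exists2 k : R, 0 < k &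
  forall alpha1 alpha2 beta C a1 a2 w1 w2 c d l1 l2 l3 K1 K2 K3,
  bilinear_estimate alpha1 alpha2 beta s b C ->
  0 < d -> d <= 1 -> 2 * d <= `|a1 + a2| -> 1 <= K1 -> 1 <= K2 -> 1 <= K3 ->
  modulated alpha1 beta a1 w1 c d l1 K1 ->
  modulated alpha2 beta a2 w2 c d l2 K2 ->
  modulated alpha1 beta (a1 + a2) (w1 + w2) c d l3 K3 ->
  k * (`|a1 + a2| * powR (jb (a1 + a2)) s * powR (jb l3) (b - 1)) <=
  `|C| * powR K3 `|b - 1| * powR K1 `|b| * powR K2 `|b| *
  (powR (jb a1) s * powR (jb l1) b * (powR (jb a2) s * powR (jb l2) b)) * Num.sqrt d^-1.
Proof.
have [Cu Cu0 HU] := @Xnorm_packet_le R s b.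
have [Cl Cl0 HL] := @Xnorm_dx_packet_ge R s (b - 1).
exists (Cl / (Cu * Cu)); first by rewrite divr_gt0// mulr_gt0.
move=> al1 al2 beta C a1 a2 w1 w2 c d l1 l2 l3 K1 K2 K3 Hest d0 d1 da K11 K21 K31 M1 M2 M3.
have k10 : 0 < d ^+ 2 / 2 by rewrite divr_gt0// exprn_gt0.
have k20 : 0 < 1 / 2 :> R by rewrite divr_gt0.
have := Hest _ _ (schwartz_packet a1 w1 c k10 k20) (schwartz_packet a2 w2 c k10 k20).
rewrite cmul_packet (_ : 2 * (d ^+ 2 / 2) = d ^+ 2); last by field.
rewrite (_ : 2 * (1 / 2) = 1); last by field.
have U1 := HU al1 beta a1 w1 c d l1 K1 d0 d1 K11 M1.
have U2 := HU al2 beta a2 w2 c d l2 K2 d0 d1 K21 M2.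
have L3 := HL al1 beta (a1 + a2) (w1 + w2) c d l3 K3 d0 d1 da K31 M3.
move=> /(le_trans L3) {L3}; set X1 := Xnorm _ _ _ _ _; set X2 := Xnorm _ _ _ _ _ => L3.
have X10 : (0 <= X1)%E by exact: sqrte_ge0.
have X20 : (0 <= X2)%E by exact: sqrte_ge0.
(* The sign of [C] is unknown, and multiplying the upper bounds of the norms requires a nonnegative
   constant. *)
have CX (X Y : \bar R) : (0 <= X -> 0 <= Y -> C%:E * X * Y <= (`|C|)%:E * X * Y)%E.
  by move=> X0 Y0; do 2 apply: lee_wpmul2r => //; rewrite lee_fin ler_norm.
have := CX X1 X2 X10 X20.
move=> /(le_trans L3) {}L3.
have C0 : (0 <= `|C|%:E)%E by rewrite lee_fin.
have := lee_pmul (mule_ge0 C0 X10) X20 (lee_pmul C0 X10 (lexx _) U1) U2.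
move=> /(le_trans L3) {L3}; rewrite -!EFinM lee_fin.
set S := Num.sqrt d^-1; have S0 : 0 < S by rewrite sqrtr_gt0 invr_gt0.
have K30 : 0 < powR K3 `|b - 1| by apply: powR_gt0; exact: lt_le_trans K31.
set A3 := `|a1 + a2| * _ * _; set A1 := powR (jb a1) s * _; set A2 := powR (jb a2) s * _.
move=> H.
rewrite mulrAC ler_pdivrMr ?mulr_gt0//.
rewrite -(ler_pM2r (divr_gt0 S0 K30)).
apply: le_trans (_ : Cl * (A3 / powR K3 `|b - 1|) * S <= _).
  by apply: le_of_eq; ring.
apply: le_trans H _; apply: le_of_eq.
move: (powR K3 _) K30 => P3 P30; field; by rewrite gt_eqF.
Qed.

(** The exact Taylor expansion of the cubic at [a], in the variable [u = (z.1 - a) / d]: [k0] bounds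
    the offset of the centre, [k1] the mismatch of slopes, [k2] the curvature and [k3] the cubic
    term; the summand [1] pays for [v]. All monomials involved are dominated by
    [jb u ^+ 3 * jb v]. *)
Lemma modulated_packet alpha beta a w c d l k0 k1 k2 k3 : 0 < d ->
  `|w - phi alpha beta a - l| <= k0 ->
  `|c - (3 * alpha * a ^+ 2 - beta)| * d <= k1 ->
  3 * `|alpha| * `|a| * d ^+ 2 <= k2 -> `|alpha| * d ^+ 3 <= k3 ->
  modulated alpha beta a w c d l (1 + k0 + k1 + k2 + k3).
Proof.
move=> d0 H0 H1 H2 H3 z; set p := z.1 - a; set v := z.2 - w - c * p; set u := p / d.
have -> : z.2 - phi alpha beta z.1 - l = (w - phi alpha beta a - l) + v +
   (c - (3 * alpha * a ^+ 2 - beta)) * d * u - 3 * alpha * a * d ^+ 2 * u ^+ 2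
   - alpha * d ^+ 3 * u ^+ 3.
  by rewrite /v /u /p /phi; field; rewrite gt_eqF.
have u0 := normr_ge0 u; have v0 := normr_ge0 v.
have jv : 1 <= jb v := jb_ge1 v.
have j3 n : (n <= 3)%N -> `|u| ^+ n <= jb u ^+ 3 * jb v.
  move=> n3; apply: le_trans (_ : jb u ^+ n <= _).
    by apply: lerXn2r; rewrite ?nnegrE ?(ltW (jb_gt0 _))// lerDr.
  apply: le_trans (_ : jb u ^+ 3 <= _); first by rewrite ler_weXn2l// jb_ge1.
  by rewrite ler_peMr// exprn_ge0// (ltW (jb_gt0 _)).
have jV : `|v| <= jb u ^+ 3 * jb v.
  apply: le_trans (_ : jb v <= _); first by rewrite lerDr.
  by rewrite ler_peMl ?(ltW (jb_gt0 _))// exprn_ege1// jb_ge1.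
set J := jb u ^+ 3 * jb v in j3 jV *.
have J1 := j3 0%N isT; have Ju := j3 1%N isT; have Ju2 := j3 2%N isT; have Ju3 := j3 3%N isT.
rewrite expr0 in J1; rewrite expr1 in Ju.
have T3 : `|alpha * d ^+ 3 * u ^+ 3| <= k3 * J.
  by rewrite 2!normrM (gtr0_norm (exprn_gt0 3 d0)) normrX; apply: ler_pM; nonneg.
have T2 : `|3 * alpha * a * d ^+ 2 * u ^+ 2| <= k2 * J.
  rewrite 4!normrM (gtr0_norm (exprn_gt0 2 d0)) normrX (ger0_norm (ler0n _ _)).
  by apply: ler_pM; nonneg.
have T1 : `|(c - (3 * alpha * a ^+ 2 - beta)) * d * u| <= k1 * J.
  by rewrite 2!normrM (gtr0_norm d0); apply: ler_pM; nonneg.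
have T0 : `|w - phi alpha beta a - l| <= k0 * J.
  rewrite (le_trans H0)// ler_peMr//; exact: le_trans H0.
set x0 := w - _ - _ in T0 *.
have := ler_normB (x0 + v + (c - (3 * alpha * a ^+ 2 - beta)) * d * u)
   (3 * alpha * a * d ^+ 2 * u ^+ 2).
have := ler_normD (x0 + v) ((c - (3 * alpha * a ^+ 2 - beta)) * d * u).
have := ler_normD x0 v.
have := ler_normB (x0 + v + (c - (3 * alpha * a ^+ 2 - beta)) * d * u -
  3 * alpha * a * d ^+ 2 * u ^+ 2) (alpha * d ^+ 3 * u ^+ 3).
have -> : (1 + k0 + k1 + k2 + k3) * J = J + k0 * J + k1 * J + k2 * J + k3 * J by ring.
move: (k0 * J) (k1 * J) (k2 * J) (k3 * J) T0 T1 T2 T3 => ? ? ? ?; lra.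
Qed.

(** With [|a| <= 3 N] and [d = N^-2], the slope costs [27 |alpha| + |beta|], the curvature
    [9 |alpha|] and the cubic term [|alpha|]. *)
Definition box_const alpha beta : R := 1 + 37 * `|alpha| + `|beta|.

Lemma modulated_box alpha beta a w N : 1 <= N -> `|a| <= 3 * N ->
  modulated alpha beta a w 0 (N ^+ 2)^-1 (w - phi alpha beta a) (box_const alpha beta).
Proof.
move=> N1 aN; have N0 : 0 < N by rewrite (lt_le_trans _ N1).
have N20 : 0 < N ^+ 2 by rewrite exprn_gt0.
have d0 : 0 < (N ^+ 2)^-1 by rewrite invr_gt0.
have d1 : (N ^+ 2)^-1 <= 1 by rewrite invf_le1// exprn_ege1.
have al0 := normr_ge0 alpha; have be0 := normr_ge0 beta.
have -> : box_const alpha beta =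
    1 + 0 + (27 * `|alpha| + `|beta|) + 9 * `|alpha| + `|alpha| by rewrite /box_const; ring.
apply: modulated_packet => //.
- by rewrite subrr normr0.
- rewrite sub0r normrN ler_pdivrMr//.
  apply: le_trans (ler_normB _ _) _; rewrite 2!normrM normrX (ger0_norm (ler0n _ _)) (mulrDl (27 * `|alpha|)).
  have a2 : `|a| ^+ 2 <= 9 * N ^+ 2.
    rewrite (_ : 9 * N ^+ 2 = (3 * N) ^+ 2); last by ring.
    by rewrite lerXn2r ?nnegrE//; nonneg.
  apply: lerD; last by rewrite ler_peMr// exprn_ege1.
  have := ler_wpM2l al0 a2; lra.
- apply: le_trans (_ : 3 * `|alpha| * (3 * N) * ((N ^+ 2)^-1) ^+ 2 <= _).
    by rewrite ler_wpM2r ?sqr_ge0// ler_wpM2l//; nonneg.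
  rewrite exprVn -exprM ler_pdivrMr ?exprn_gt0//.
  have N4 : N <= N ^+ 4 by rewrite ler_eXnr.
  have := ler_wpM2l al0 N4; lra.
- by rewrite ler_piMr// exprn_ile1// ltW.
Qed.

Lemma box_const_ge1 alpha beta : 1 <= box_const alpha beta.
Proof. by rewrite /box_const -addrA lerDl; nonneg. Qed.

Lemma box_test s b alpha1 alpha2 beta C :
  bilinear_estimate alpha1 alpha2 beta s b C ->
  exists2 D : R, 0 < D & forall a1 a2 w1 w2 l1 l2 l3 N,
    1 <= N -> `|a1| <= 3 * N -> `|a2| <= 3 * N -> `|a1 + a2| <= 3 * N ->
    2 <= N ^+ 2 * `|a1 + a2| ->
    l1 = w1 - phi alpha1 beta a1 -> l2 = w2 - phi alpha2 beta a2 ->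
    l3 = w1 + w2 - phi alpha1 beta (a1 + a2) ->
    `|a1 + a2| * powR (jb (a1 + a2)) s * powR (jb l3) (b - 1) <=
    D * (powR (jb a1) s * powR (jb l1) b * (powR (jb a2) s * powR (jb l2) b)) * N.
Proof.
move=> Hest; have [k k0 Hk] := packet_test s b.
have B1 := box_const_ge1 alpha1 beta; have B2 := box_const_ge1 alpha2 beta.
set K1 := box_const alpha1 beta in B1 *; set K2 := box_const alpha2 beta in B2 *.
pose D0 := `|C| * powR K1 `|b - 1| * powR K1 `|b| * powR K2 `|b|.
(* Adding [1] keeps the constant positive when [C = 0]. *)
exists ((1 + D0) / k).
  by rewrite divr_gt0// ltr_wpDr// /D0; nonneg.
move=> a1 a2 w1 w2 l1 l2 l3 N N1 a1N a2N a3N a3 -> -> ->.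
have N0 : 0 < N by rewrite (lt_le_trans _ N1).
have N20 : 0 < N ^+ 2 by rewrite exprn_gt0.
have d0 : 0 < (N ^+ 2)^-1 by rewrite invr_gt0.
have d1 : (N ^+ 2)^-1 <= 1 by rewrite invf_le1// exprn_ege1.
have da : 2 * (N ^+ 2)^-1 <= `|a1 + a2| by rewrite ler_pdivrMr// mulrC.
have := Hk _ _ _ _ _ _ _ _ _ _ _ _ _ _ _ _ Hest d0 d1 da B1 B2 B1
  (modulated_box _ _ w1 N1 a1N) (modulated_box _ _ w2 N1 a2N) (modulated_box _ _ _ N1 a3N).
rewrite invrK sqrtr_sqr (gtr0_norm N0) -/D0.
rewrite -ler_pdivlMl// => /le_trans; apply.
set Q := powR (jb a1) s * _ * _.
have Q0 : 0 <= Q by rewrite /Q; nonneg.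
apply: le_trans (_ : D0 / k * Q * N <= _); first by apply: le_of_eq; ring.
apply: ler_wpM2r; first exact: ltW.
apply: ler_wpM2r => //; apply: ler_wpM2r; first by rewrite invr_ge0 ltW.
by rewrite lerDr.
Qed.

Lemma powR_unbounded e N0 D : 0 < e -> exists2 N, N0 <= N & D < powR N e.
Proof.
move=> e0; pose M := powR (`|D| + 1) e^-1.
exists (Num.max N0 M); first by rewrite le_max lexx.
have D1 : 0 < `|D| + 1 by rewrite ltr_wpDl.
apply: lt_le_trans (_ : `|D| + 1 <= _).
  by rewrite (le_lt_trans (ler_norm _))// ltrDl.
have -> : `|D| + 1 = powR M e by rewrite /M -powRrM mulVf ?gt_eqF// powRr1// ltW.
have M0 : 0 <= M by rewrite powR_ge0.
apply: ge0_ler_powR; rewrite ?nnegrE ?(ltW e0)//; first by rewrite le_max M0 orbT.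
by rewrite le_max lexx orbT.
Qed.

(** [Q] collects the powers common to both sides, so each test only has to exhibit a positive gap
    [e] between exponents. *)
Lemma powR_absurd e N0 k D : 0 < e -> 0 < k ->
  (forall N, N0 <= N -> exists2 Q, 0 < Q & k * (powR N e * Q) <= D * Q) -> False.
Proof.
move=> e0 k0 H; have [N NN0 ND] := powR_unbounded N0 (D / k) e0.
have [Q Q0] := H N NN0; rewrite mulrA ler_pM2r// -ler_pdivlMl// mulrC.
by rewrite leNgt ND.
Qed.

Lemma powR_comparable (k x y : R) s : 1 <= k -> 0 < x -> 0 < y ->
  x <= k * y -> y <= k * x ->
  powR x s <= powR k `|s| * powR y s /\ powR y s <= powR k `|s| * powR x s.
Proof.
move=> k1; have k0 : 0 < k by rewrite (lt_le_trans _ k1).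
have aux x' y' : 0 < x' -> 0 < y' -> x' <= k * y' -> y' <= k * x' ->
    powR x' s <= powR k `|s| * powR y' s.
  move=> x0 y0 xy yx; have [s0|s0] := leP 0 s.
    rewrite ger0_norm// -powRM ?(ltW y0) ?(ltW k0)// ge0_ler_powR ?nnegrE ?mulr_ge0 ?(ltW x0) ?(ltW y0) ?(ltW k0)//.
  rewrite ltr0_norm//; have q0 : 0 <= - s by rewrite oppr_ge0 ltW.
  rewrite -[in powR x' s](opprK s) -[in powR y' s](opprK s).
  move: (- s) q0 => q q0; rewrite !powRN.
  rewrite -[_^-1]mul1r ler_pdivrMr ?powR_gt0// mulrAC ler_pdivlMr ?powR_gt0// mul1r.
  by rewrite -powRM ?(ltW k0) ?(ltW x0)// ge0_ler_powR ?nnegrE ?mulr_ge0 ?(ltW x0) ?(ltW y0) ?(ltW k0).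
by move=> x0 y0 xy yx; split; exact: aux.
Qed.

Lemma jb_comparable A B l N : 0 < A -> 1 <= N -> A * N ^+ 3 <= `|l| -> `|l| <= B * N ^+ 3 ->
  let k := 1 + A^-1 + `|B| in
  [/\ 1 <= k, jb l <= k * N ^+ 3 & N ^+ 3 <= k * jb l].
Proof.
move=> A0 N1 Al lB k.
have N3 : 1 <= N ^+ 3 by rewrite exprn_ege1.
have N30 : 0 <= N ^+ 3 by rewrite (le_trans _ N3).
have A0' : 0 <= A^-1 by rewrite invr_ge0 ltW.
split; first by rewrite /k -addrA lerDl; nonneg.
- rewrite /jb /k; have := ler_wpM2r N30 (ler_norm B); have := mulr_ge0 A0' N30; nra.
- apply: le_trans (_ : A^-1 * `|l| <= _); first by rewrite ler_pdivlMl.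
  by rewrite ler_pM// /jb ?lerDr// /k -addrA addrCA lerDl; nonneg.
Qed.

End Counterexamples.

(** * The three necessary conditions on [b] *)

Section Cases.
Variable R : realType.
Implicit Types s b N : R.

Lemma powRDp N (x y : R) : 0 < N -> powR N (x + y) = powR N x * powR N y.
Proof. by move=> N0; rewrite powRD// (gt_eqF N0) implybT. Qed.

Lemma powRXn N (n : nat) (x : R) : 0 <= N -> powR (N ^+ n) x = powR N (n%:R * x).
Proof. by move=> N0; rewrite powRrM powR_mulrn. Qed.

(** Absence of resonance: the two contributions to a modulation cannot cancel, so it is bounded
    below as well as above by multiples of [N^3]. *)
Lemma normr_opp_sign (a1 a2 x y : R) : a1 * a2 < 0 -> 0 <= x -> 0 <= y ->
  `|a1 * x - a2 * y| = `|a1| * x + `|a2| * y.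
Proof.
move=> a12 x0 y0; have [a10|a10|a10] := ltgtP a1 0; last by rewrite a10 mul0r ltxx in a12.
  have a20 : 0 < a2 by rewrite -(nmulr_rlt0 _ a10).
  rewrite (ltr0_norm a10) (gtr0_norm a20) ler0_norm; first by ring.
  by rewrite subr_le0 (le_trans (_ : _ <= 0))// ?mulr_ge0 ?(ltW a20)// mulr_le0_ge0// ltW.
have a20 : a2 < 0 by rewrite -(pmulr_rlt0 _ a10).
rewrite (ltr0_norm a20) (gtr0_norm a10) ger0_norm; first by ring.
by rewrite subr_ge0 (le_trans (_ : _ <= 0))// ?mulr_ge0 ?(ltW a10)// mulr_le0_ge0// ltW.
Qed.

Lemma jb0 : jb 0 = 1 :> R.
Proof. by rewrite /jb normr0 addr0. Qed.

Lemma jb_linear (m : R) N s : 1 <= m -> 1 <= N ->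
  powR (jb (m * N)) s <= powR (1 + m) `|s| * powR N s /\
  powR N s <= powR (1 + m) `|s| * powR (jb (m * N)) s.
Proof.
move=> m1 N1; have N0 : 0 < N by rewrite (lt_le_trans _ N1).
have m0 : 0 < m by rewrite (lt_le_trans _ m1).
apply: powR_comparable => //; rewrite ?jb_gt0//.
- by rewrite lerDl ltW.
- by rewrite /jb normrM !gtr0_norm// mulrDl mul1r lerD2r.
- rewrite /jb normrM !gtr0_norm//.
  have H1 : N <= m * N by rewrite ler_peMl// ltW.
  have H2 : 0 <= m * (m * N) by nonneg.
  lra.
Qed.

Variables alpha1 alpha2 beta s b C : R.
Hypothesis opposite : alpha1 * alpha2 < 0.
Hypothesis estimate : bilinear_estimate alpha1 alpha2 beta s b C.

Let a1_gt0 : 0 < `|alpha1|.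
Proof. by rewrite normr_gt0; apply: contraTneq opposite => ->; rewrite mul0r ltxx. Qed.

Let a2_gt0 : 0 < `|alpha2|.
Proof. by rewrite normr_gt0; apply: contraTneq opposite => ->; rewrite mulr0 ltxx. Qed.

(** The output has frequency [1], so neither the derivative nor the frequency weight contributes to
    the growth of the left side: it comes entirely from the modulation. *)
Lemma high_high_low : b <= 4 / 3 + 2 * s / 3.
Proof.
rewrite leNgt; apply/negP => hb.
have [D D0 HD] := box_test estimate.
(* The left side grows like [N^(3(b-1))] and the right side like [N^(2s+1)], the last [N] being
   [d^(-1/2)]. *)
pose e := 3 * (b - 1) - 2 * s - 1.
have e0 : 0 < e by rewrite /e; lra.
pose k := 1 + (`|alpha1| / 2)^-1 + `|(`|alpha1| + `|alpha2|)|.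
have A0 : 0 < `|alpha1| / 2 by rewrite divr_gt0.
have k0 : 0 < k by rewrite /k -addrA ltr_pwDl//; nonneg.
have kk0 : 0 < powR 2 s / powR k `|b - 1| by rewrite divr_gt0 ?powR_gt0.
apply: (@powR_absurd _ e 2 _ (D * powR (1 + 1) `|s|) e0 kk0) => N N2.
have N1 : 1 <= N by lra.
have N0 : 0 < N by lra.
exists (powR N s * powR N s * N); first by rewrite !mulr_gt0 ?powR_gt0.
(* The distance of the output centre from the output curve; [N >= 2] gives [N^3 - 1 >= N^3 / 2],
   hence the lower constant [|alpha1| / 2]. *)
pose l3 := alpha1 * (N ^+ 3 - 1) - alpha2 * (N - 1) ^+ 3.
have N1' : 0 <= N - 1 by lra.
have N3 : 2 <= N ^+ 3 by apply: le_trans N2 _; rewrite ler_eXnr.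
have N3' : 0 <= N ^+ 3 - 1 by lra.
have l3E : `|l3| = `|alpha1| * (N ^+ 3 - 1) + `|alpha2| * (N - 1) ^+ 3.
  by rewrite normr_opp_sign// exprn_ge0.
have NN : (N - 1) ^+ 3 <= N ^+ 3 by rewrite lerXn2r ?nnegrE//; lra.
have al1 : `|alpha1| / 2 * N ^+ 3 <= `|l3|.
  rewrite l3E -[X in X <= _]addr0 lerD//; last by nonneg.
  rewrite -mulrA ler_wpM2l//; lra.
have al2 : `|l3| <= (`|alpha1| + `|alpha2|) * N ^+ 3.
  rewrite l3E mulrDl lerD// ler_wpM2l//; lra.
have [k1 lk1 lk2] := jb_comparable A0 N1 al1 al2.
have [_ lk] := powR_comparable (b - 1) k1 (jb_gt0 l3) (exprn_gt0 3 N0) lk1 lk2.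
have aE : N + (1 - N) = 1 by ring.
have nN : `|1 - N| = N - 1 by rewrite distrC ger0_norm.
have := HD N (1 - N) (phi alpha1 beta N) (phi alpha2 beta (1 - N)) 0 0 l3 N N1.
rewrite aE normr1 nN (gtr0_norm N0) !subrr mulr1 mul1r.
have h1 : N <= 3 * N by lra.
have h2 : N - 1 <= 3 * N by lra.
have h3 : 1 <= 3 * N by lra.
have h4 : 2 <= N ^+ 2 by apply: le_trans N2 _; rewrite ler_eXnr.
have h5 : l3 = phi alpha1 beta N + phi alpha2 beta (1 - N) - phi alpha1 beta 1.
  by rewrite /l3 /phi; ring.
move=> /(_ h1 h2 h3 h4 erefl erefl h5).
have [jN _] := @jb_linear 1 N s (lexx _) N1; rewrite mul1r in jN.
rewrite jb0 !powR1 !mulr1 (_ : jb (1 - N) = N); last by rewrite /jb nN; ring.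
rewrite (_ : jb 1 = 2); last by rewrite /jb normr1.
move=> H.
have -> : powR N e * (powR N s * powR N s * N) = powR (N ^+ 3) (b - 1).
  rewrite powRXn ?ltW// -{4}(powRr1 (ltW N0)) -!powRDp//; congr powR; rewrite /e; ring.
rewrite mulrAC ler_pdivrMr ?powR_gt0//.
apply: le_trans (_ : powR 2 s * (powR k `|b - 1| * powR (jb l3) (b - 1)) <= _).
  by rewrite ler_wpM2l ?powR_ge0.
rewrite mulrCA mulrC ler_wpM2r ?powR_ge0//.
apply: le_trans H _.
rewrite -!mulrA ler_wpM2l ?(ltW D0)// !mulrA ler_wpM2r ?(ltW N0)// ler_wpM2r ?powR_ge0//.
Qed.

(** The output frequency [2N] adds a factor [N^(1+s)] on the left to the previous test, so this
    condition is the stronger one exactly when [s > -1]. *)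
Lemma high_high_high : b <= 1 + s / 3.
Proof.
rewrite leNgt; apply/negP => hb.
have [D D0 HD] := box_test estimate.
pose e := 3 * (b - 1) - s.
have e0 : 0 < e by rewrite /e; lra.
pose B := `|alpha1| * 7 + `|alpha2|.
have B0 : 0 < B by rewrite /B; have := a1_gt0; have := a2_gt0; lra.
pose k := 1 + B^-1 + `|B|.
have k0 : 0 < k by rewrite /k -addrA ltr_pwDl//; nonneg.
have kk0 : 0 < 2 / powR (1 + 2) `|s| / powR k `|b - 1| by rewrite !divr_gt0 ?powR_gt0.
apply: (@powR_absurd _ e 2 _ (D * powR (1 + 1) `|s| * powR (1 + 1) `|s|) e0 kk0) => N N2.
have N1 : 1 <= N by lra.
have N0 : 0 < N by lra.
exists (powR N s * powR N s * N); first by rewrite !mulr_gt0 ?powR_gt0.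
(* The [7] is [2^3 - 1]: output curve at [2N] minus first curve at [N]. *)
pose l3 := - (alpha1 * (7 * N ^+ 3) - alpha2 * N ^+ 3).
have l3E : `|l3| = B * N ^+ 3.
  by rewrite normrN normr_opp_sign//; [rewrite /B; ring|nonneg|nonneg].
have al1 : B * N ^+ 3 <= `|l3| by rewrite l3E.
have al2 : `|l3| <= B * N ^+ 3 by rewrite l3E.
have [k1 lk1 lk2] := jb_comparable B0 N1 al1 al2.
have [_ lk] := powR_comparable (b - 1) k1 (jb_gt0 l3) (exprn_gt0 3 N0) lk1 lk2.
have := HD N N (phi alpha1 beta N) (phi alpha2 beta N) 0 0 l3 N N1.
have aE : N + N = 2 * N by ring.
rewrite aE normrM (gtr0_norm N0) !subrr ger0_norm//.
have h1 : N <= 3 * N by lra.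
have h2 : 2 * N <= 3 * N by lra.
have h4 : 2 <= N ^+ 2 * (2 * N).
  have : N <= N ^+ 3 by rewrite ler_eXnr.
  rewrite mulrCA -exprSr; lra.
have h5 : l3 = phi alpha1 beta N + phi alpha2 beta N - phi alpha1 beta (2 * N).
  by rewrite /l3 /phi; ring.
move=> /(_ h1 h1 h2 h4 erefl erefl h5).
have [jN _] := @jb_linear 1 N s (lexx _) N1; rewrite mul1r in jN.
have [_ j2N] := @jb_linear 2 N s (ler1n _ 2) N1.
rewrite jb0 !powR1 !mulr1 => H.
have -> : powR N e * (powR N s * powR N s * N) = powR N s * N * powR (N ^+ 3) (b - 1).
  have -> : powR N s * N * powR (N ^+ 3) (b - 1) = powR N s * powR N 1 * powR N (3 * (b - 1)).
    by rewrite powRXn ?powRr1// ltW.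
  have -> : powR N s * powR N s * N = powR N s * powR N s * powR N 1 by rewrite powRr1// ltW.
  rewrite -!powRDp//; congr powR; rewrite /e; ring.
apply: le_trans (_ : 2 * N * powR (jb (2 * N)) s * powR (jb l3) (b - 1) <= _).
  have {}j2N : powR N s / powR (1 + 2) `|s| <= powR (jb (2 * N)) s.
    by rewrite ler_pdivrMr ?powR_gt0// mulrC.
  have {}lk : powR (N ^+ 3) (b - 1) / powR k `|b - 1| <= powR (jb l3) (b - 1).
    by rewrite ler_pdivrMr ?powR_gt0// mulrC.
  rewrite [X in X <= _](_ : _ = 2 * N * (powR N s / powR (1 + 2) `|s|) *
    (powR (N ^+ 3) (b - 1) / powR k `|b - 1|)); last by ring.
  by apply: ler_pM => //; [nonneg|nonneg|rewrite ler_wpM2l//; nonneg].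
apply: le_trans H _.
rewrite [X in _ <= X](_ : _ = D * (powR (1 + 1) `|s| * powR N s *
  (powR (1 + 1) `|s| * powR N s)) * N); last by ring.
rewrite ler_wpM2r ?(ltW N0)// ler_wpM2l ?(ltW D0)//.
by apply: ler_pM => //; exact: powR_ge0.
Qed.

Let linear_freq N : 1 <= N -> `|-2 * N| = 2 * N.
Proof. by move=> N1; rewrite normrM normrN !ger0_norm//; lra. Qed.

Let jb_opp (x : R) : jb (- x) = jb x.
Proof. by rewrite /jb normrN. Qed.

(** For [b <= 0] there is enough room for the narrow packets [d = N^-2], for which
    the slope of the curve is irrelevant. *)
Lemma high_output_nonpos : s < 0 -> b <= 0 -> False.
Proof.
move=> s0 b0.
have [D D0 HD] := box_test estimate.
(* This compares [N^(1+s)] with [N^(2s+3b+1)]. It only yields [b >= - s / 3], which is already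
   impossible when [s < 0] and [b <= 0]. *)
pose e := - s - 3 * b.
have e0 : 0 < e by rewrite /e; lra.
pose B := `|alpha1| * 2 + `|alpha2| * 8.
have B0 : 0 < B by rewrite /B; have := a1_gt0; have := a2_gt0; lra.
pose k := 1 + B^-1 + `|B|.
apply: (@powR_absurd _ e 2 1 (D * powR (1 + 2) `|s| * powR k `|b|) e0 ltr01) => N N2.
have N1 : 1 <= N by lra.
have N0 : 0 < N by lra.
exists (powR (jb N) s * (powR N s * powR N (3 * b)) * N).
  by rewrite !mulr_gt0 ?powR_gt0 ?jb_gt0.
(* [phi] is odd, so the second packet must be centred at height [- 2 * phi alpha1 beta N] for the
   output to lie on its curve at [- N]; this is the resulting distance to the second curve. *)
pose l2 := - (alpha1 * (2 * N ^+ 3) - alpha2 * (8 * N ^+ 3)).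
have l2E : `|l2| = B * N ^+ 3.
  by rewrite normrN normr_opp_sign//; [rewrite /B; ring|nonneg|nonneg].
have al1 : B * N ^+ 3 <= `|l2| by rewrite l2E.
have al2 : `|l2| <= B * N ^+ 3 by rewrite l2E.
have [k1 lk1 lk2] := jb_comparable B0 N1 al1 al2.
have [lk _] := powR_comparable b k1 (jb_gt0 l2) (exprn_gt0 3 N0) lk1 lk2.
have := HD N (-2 * N) (phi alpha1 beta N) (- 2 * phi alpha1 beta N) 0 l2 0 N N1.
have aE : N + -2 * N = - N by ring.
rewrite aE normrN linear_freq// (gtr0_norm N0) subrr.
have h1 : N <= 3 * N by lra.
have h2 : 2 * N <= 3 * N by lra.
have h4 : 2 <= N ^+ 2 * N.
  have : N <= N ^+ 3 by rewrite ler_eXnr.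
  rewrite -exprSr; lra.
have h5 : l2 = - 2 * phi alpha1 beta N - phi alpha2 beta (-2 * N).
  by rewrite /l2 /phi; ring.
have h6 : 0 = phi alpha1 beta N + - 2 * phi alpha1 beta N - phi alpha1 beta (- N) :> R.
  by rewrite /phi; ring.
move=> /(_ h1 h2 h1 h4 erefl h5 h6).
have [j2N _] := @jb_linear 2 N s (ler1n _ 2) N1.
rewrite jb0 !powR1 !mulr1 jb_opp (_ : jb (-2 * N) = jb (2 * N)); last by rewrite mulNr jb_opp.
move=> H; rewrite mul1r.
have -> : powR N e * (powR (jb N) s * (powR N s * powR N (3 * b)) * N) = N * powR (jb N) s.
  have -> : powR N e * (powR (jb N) s * (powR N s * powR N (3 * b)) * N) =
     powR N e * (powR N s * powR N (3 * b)) * (N * powR (jb N) s) by ring.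
  rewrite -!powRDp// (_ : e + (s + 3 * b) = 0); last by rewrite /e; ring.
  by rewrite powRr0 mul1r.
apply: le_trans H _.
rewrite -(powRXn 3 b (ltW N0)).
rewrite [X in _ <= X](_ : _ = D * (powR (jb N) s * (powR (1 + 2) `|s| * powR N s *
  (powR k `|b| * powR (N ^+ 3) b))) * N); last by ring.
rewrite ler_wpM2r ?(ltW N0)// ler_wpM2l ?(ltW D0)// ler_wpM2l ?powR_ge0//.
by apply: ler_pM => //; exact: powR_ge0.
Qed.

(** The derivative of [phi] is even, so the curve has the same slope at [N] and [- N], and one shear
    serves the first packet and the output. Replacing the width [N^-2] by [N^(-1/2)] lowers
    [d^(-1/2)] from [N] to [N^(1/4)]; the gain [N^(3/4)] against [N^(3b)] is the [1/4] in the
    bound. *)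
Lemma high_output : s < 0 -> 4^-1 - s / 3 <= b.
Proof.
move=> s0; rewrite leNgt; apply/negP => hb.
have [b0|b0] := leP b 0; first exact: high_output_nonpos.
have [q q0 Hq] := packet_test s b.
(* Exponents are counted in [m], with [N = m^2]: apart from the common weight at [N], the left side
   is [m^2] and the right side [m^(2s + 6b + 1/2)]. *)
pose e := 3 / 2 - 2 * s - 6 * b.
have e0 : 0 < e by rewrite /e; lra.
(* The zeros record that the centre is on the curve and the slope is tangent; the curvature term is
   bounded because [d^2 N = 1]. *)
pose K1 := 1 + 0 + 0 + 3 * `|alpha1| + `|alpha1|.
(* Offset, slope, curvature and cubic contributions of the second packet, taken at frequency [-2N].
   Its slope mismatch is of order [N^2], so everything fits under [N^3]. *)
pose k2 := 1 + (8 * `|alpha2| + 2 * `|alpha1|) + (3 * `|alpha1| + 12 * `|alpha2|) +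
   6 * `|alpha2| + `|alpha2|.
have K11 : 1 <= K1 by rewrite /K1 !addr0 -addrA lerDl; nonneg.
have k21 : 1 <= k2 by rewrite /k2 -!addrA lerDl; nonneg.
pose D := `|C| * powR K1 `|b - 1| * powR K1 `|b| * powR k2 `|b| * powR (1 + 2) `|s|.
apply: (@powR_absurd _ e 2 q D e0 q0) => m m2.
have m1 : 1 <= m by lra.
have m0 : 0 < m by lra.
(* [d = 1 / m = N^(-1/2)]; the first and output packets follow their curve with slope [c]. *)
pose N := m ^+ 2.
have N1 : 1 <= N by rewrite exprn_ege1.
have N0 : 0 < N by rewrite exprn_gt0.
have N2 : 2 <= N by apply: le_trans m2 _; rewrite ler_eXnr.
exists (powR (jb N) s * (powR m (2 * s) * powR m (6 * b)) * powR m (1 / 2)).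
  by rewrite !mulr_gt0 ?powR_gt0 ?jb_gt0.
pose c := 3 * alpha1 * N ^+ 2 - beta.
have d0 : 0 < m^-1 by rewrite invr_gt0.
have d1 : m^-1 <= 1 by rewrite invf_le1.
have aE : N + -2 * N = - N by ring.
have da : 2 * m^-1 <= `|N + -2 * N|.
  by rewrite aE normrN gtr0_norm//; lra.
have N31 : 1 <= N ^+ 3 by rewrite exprn_ege1.
have K21 : 1 <= k2 * N ^+ 3 by rewrite mulr_ege1.
have md2 : m^-1 ^+ 2 * N = 1 by rewrite /N exprVn mulVf// gt_eqF// exprn_gt0.
have md3 : m^-1 ^+ 3 <= 1 by rewrite exprn_ile1// ltW.
have M1 : modulated alpha1 beta N (phi alpha1 beta N) c m^-1 0 K1.
  apply: modulated_packet => //.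
  - by rewrite subrr subr0 normr0.
  - by rewrite subrr normr0 mul0r.
  - by rewrite (gtr0_norm N0) -mulrA [N * _]mulrC md2 mulr1.
  - by rewrite ler_piMr.
have M3 : modulated alpha1 beta (N + -2 * N) (phi alpha1 beta N + - 2 * phi alpha1 beta N)
    c m^-1 0 K1.
  rewrite aE; apply: modulated_packet => //.
  - by rewrite /phi (_ : _ - 0 = 0) ?normr0//; ring.
  - by rewrite sqrrN subrr normr0 mul0r.
  - by rewrite normrN (gtr0_norm N0) -mulrA [N * _]mulrC md2 mulr1.
  - by rewrite ler_piMr.
have normM (k a : R) n : 0 <= k -> `|k * a * N ^+ n| = k * `|a| * N ^+ n.
  by move=> k0; rewrite 2!normrM normrX (gtr0_norm N0) (ger0_norm k0).
have N23 : N ^+ 2 <= N ^+ 3 by rewrite ler_weXn2l.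
(* As [b > 0], only an upper bound of the modulation of the second packet matters,
   so that it can be measured from [l = 0] at the cost of the factor [N^3]. *)
have M2 : modulated alpha2 beta (-2 * N) (- 2 * phi alpha1 beta N) c m^-1 0 (k2 * N ^+ 3).
  move=> z; apply: le_trans (_ : (1 + (8 * `|alpha2| + 2 * `|alpha1|) * N ^+ 3 +
    (3 * `|alpha1| + 12 * `|alpha2|) * N ^+ 2 + 6 * `|alpha2| + `|alpha2|) *
    (jb ((z.1 - -2 * N) / m^-1) ^+ 3 * jb (z.2 - - 2 * phi alpha1 beta N - c * (z.1 - -2 * N)))
    <= _).
    apply: modulated_packet => //.
    - rewrite subr0 (_ : _ - _ = 8 * alpha2 * N ^+ 3 - 2 * alpha1 * N ^+ 3); last first.
        by rewrite /phi; ring.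
      rewrite (le_trans (ler_normB _ _))// !normM//.
      by apply: le_of_eq; ring.
    - rewrite (_ : c - _ = 3 * alpha1 * N ^+ 2 - 12 * alpha2 * N ^+ 2); last first.
        by rewrite /c; ring.
      apply: le_trans (ler_piMr _ d1) _; first by nonneg.
      rewrite (le_trans (ler_normB _ _))// !normM//.
      by apply: le_of_eq; ring.
    - rewrite linear_freq// (_ : _ * _ = 6 * `|alpha2| * (m^-1 ^+ 2 * N)); last by ring.
      by rewrite md2 mulr1.
    - by rewrite ler_piMr.
  rewrite ler_wpM2r; [by []|by nonneg|].
  have A0 : 0 <= 3 * `|alpha1| + 12 * `|alpha2| by nonneg.
  have H1 := ler_wpM2l A0 N23.
  have A20 : 0 <= 7 * `|alpha2| by nonneg.
  have H2 := ler_peMr A20 N31.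
  by rewrite /k2; lra.
have := Hq _ _ _ _ _ _ _ _ _ _ _ _ _ _ _ _ estimate d0 d1 da K11 K21 K11 M1 M2 M3.
rewrite aE normrN (gtr0_norm N0) jb0 !powR1 !mulr1 jb_opp mulNr jb_opp => H.
have [j2N _] := @jb_linear 2 N s (ler1n _ 2) N1.
have -> : powR m e * (powR (jb N) s * (powR m (2 * s) * powR m (6 * b)) * powR m (1 / 2)) =
    N * powR (jb N) s.
  have -> : powR m e * (powR (jb N) s * (powR m (2 * s) * powR m (6 * b)) * powR m (1 / 2)) =
    powR m e * (powR m (2 * s) * powR m (6 * b)) * powR m (1 / 2) * powR (jb N) s by ring.
  rewrite -!powRDp// (_ : _ + 1 / 2 = 2%:R); last by rewrite /e; field.
  by rewrite powR_mulrn ?(ltW m0).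
apply: le_trans H _.
rewrite invrK -powR12_sqrt ?(ltW m0)// mul1r.
rewrite (gtr0_norm b0).
have -> : powR (k2 * N ^+ 3) b = powR k2 b * powR m (6 * b).
  rewrite powRM ?(le_trans ler01)// /N -exprM powRXn ?(ltW m0)//.
rewrite /N (powRXn 2 s (ltW m0)) -/N in j2N.
pose G := `|C| * powR K1 `|b - 1| * powR K1 b * powR k2 b *
  powR (jb N) s * powR m (6 * b) * powR m 2^-1.
apply: le_trans (_ : G * powR (jb (2 * N)) s <= _).
  by apply: le_of_eq; rewrite /G; ring.
apply: le_trans (_ : G * (powR (1 + 2) `|s| * powR m (2 * s)) <= _).
  by rewrite ler_wpM2l// /G; nonneg.
by apply: le_of_eq; rewrite /G /D (gtr0_norm b0); ring.
Qed.

End Cases.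

Theorem theorem1p13 (R : realType) (alpha1 alpha2 beta s b : R) :
  alpha1 * alpha2 < 0 ->
  (s < - (13%:R / 12%:R)
   \/ (- (13%:R / 12%:R) <= s <= -1 /\
       ~ (4%:R^-1 - s / 3%:R <= b <= 4%:R / 3%:R + 2%:R * s / 3%:R))
   \/ (-1 < s < - (3%:R / 4%:R) /\
       ~ (4%:R^-1 - s / 3%:R <= b <= 1 + s / 3%:R))) ->
  ~ (exists C : R, forall w1 w2 : cfun R, schwartz w1 -> schwartz w2 ->
       (Xnorm alpha1 beta s (b - 1) (dx (cmul w1 w2))
        <= C%:E * Xnorm alpha1 beta s b w1 * Xnorm alpha2 beta s b w2)%E).
Proof.
move=> opposite hsb [C estimate].
have U1 := high_high_low opposite estimate.
have U2 := high_high_high opposite estimate.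
have s0 : s < 0 by case: hsb => [|[[/andP[_ ?] _]|[/andP[_ ?] _]]]; lra.
have L := high_output opposite estimate s0.
case: hsb => [s1|[[_ []]|[_ []]]].
- lra.
- by rewrite L U1.
- by rewrite L U2.
Qed.
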